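(* Let $\varphi:V\to\hat S(V)$ be a quasi-homomorphism, and define $\psi(\varepsilon_i)=\sum_{j=1}^{n+m}L_{ij}\varphi(\varepsilon_j)$ for $i=1,\dots,n+m$, where $L$ is the quantum Moser matrix. Then $\psi$ has a unique linear extension to the whole space $V$, and this extension is a quasi-homomorphism to $\hat S(V)$.
   Context: $n,m$ are positive integers and $k\in\mathbb C$ is not rational. Parity: $p(i)=0$ for $1\le i\le n$, $p(i)=1$ for $n<i\le n+m$. $V$ is the complex vector space with basis $\varepsilon_1,\dots,\varepsilon_{n+m}$ and symmetric bilinear form $(\varepsilon_i,\varepsilon_j)=\delta_{ij}k^{p(i)}$. Roots $R=\{\varepsilon_i-\varepsilon_j:i\ne j\}$; the parity of $\varepsilon_i-\varepsilon_j$ is $p(i)+p(j)\in\mathbb Z_2$; $R_0,R_1$ are the even and odd roots. $s_\alpha(v)=v-\frac{2(v,\alpha)}{(\alpha,\alpha)}\alpha$ for $\alpha\in R$; the $s_\alpha$ with $\alpha\in R_0$ generate $S_n\times S_m$. The group generated by all $s_\alpha$ acts on the algebra $\mathbb C[[V]]$ of formal power series in $\varepsilon_1,\dots,\varepsilon_{n+m}$. $\hat S(V)\subset\mathbb C[[V]]$ is the subalgebra spanned by $e^v$, where $v\in V$ has integer coordinates in the basis $\varepsilon_i$; with $x_i=e^{\varepsilon_i}$ it is identified with $\mathbb C[x_1^{\pm1},\dots,x_{n+m}^{\pm1}]$. A linear map $\varphi:V\to\mathbb C[[V]]$ is a quasi-homomorphism if it commutes with the action of $S_n\times S_m$ and $s_\alpha\varphi(v)-\varphi(s_\alpha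 v)\in(\alpha^2)$ (ideal of $\mathbb C[[V]]$ generated by $\alpha^2$) for all $\alpha\in R_1$, $v\in V$. A quasi-homomorphism to $\hat S(V)$ is one whose image lies in $\hat S(V)$. $\partial_v$ ($v\in V$) is the derivation with $\partial_v(u)=(v,u)$ for $u\in V$; so $\partial_{\varepsilon_i}=k^{p(i)}x_i\frac{\partial}{\partial x_i}$. The quantum Moser matrix has entries $$L_{ii}=\partial_{\varepsilon_i}-\sum_{j\ne i}k^{1-p(j)}\frac{x_i}{x_i-x_j},\qquad L_{ij}=k^{1-p(j)}\frac{x_i}{x_i-x_j}\ (i\ne j);$$ a priori $\psi(\varepsilon_i)$ is a rational function of the $x_i$. *)

(* Defs.v *)
From HB Require Import structures.
From mathcomp Require Import all_boot all_order all_fingroup all_algebra.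
From mathcomp Require Import fraction mpoly complex.
From mathcomp Require Import boolp reals.

Set Implicit Arguments.
Unset Strict Implicit.
Unset Printing Implicit Defensive.

Import GRing.Theory.
Local Open Scope ring_scope.

Section Homogeneous.
Context (C : fieldType) (N : nat).
Implicit Types (p q : {mpoly C[N]}).

Definition linform (v : 'rV[C]_N) : {mpoly C[N]} := \sum_i v 0 i *: 'X_i.

Lemma linform_homog v : linform v \is 1.-homog.
Proof.
by apply/rpred_sum => i _; apply/rpredZ; rewrite dhomogX /= mdeg1.
Qed.

Lemma linformP a u v : linform (a *: u + v) = a *: linform u + linform v.
Proof.
rewrite /linform scaler_sumr -big_split /=; apply: eq_bigr => i _.
by rewrite !mxE scalerDl scalerA.
Qed.

Lemma mderiv_homog d p i : p \is d.+1.-homog -> p^`M(i) \is d.-homog.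
Proof.
move=> hp; apply/dhomogP => a; rewrite mcoeff_msupp mcoeff_mderiv => ha.
have : p@_(a + U_(i)) != 0 by apply: contraNneq ha => ->; rewrite mul0rn.
by rewrite -mcoeff_msupp => /(dhomog_mf hp) /=; rewrite mdegD mdeg1 addn1 => -[].
Qed.

Lemma comp_homog d p (t : N.-tuple {mpoly C[N]}) :
  (forall i, tnth t i \is 1.-homog) -> p \is d.-homog -> p \mPo t \is d.-homog.
Proof.
move=> ht hp; rewrite comp_mpolyEX big_seq; apply/rpred_sum => a ha.
apply/rpredZ; rewrite comp_mpolyX -(dhomog_mf hp ha) /= mdegE.
elim/big_rec2: _ => [|i e q _ IH]; first exact: dhomog1.
by apply: dhomogM => //; have := dhomogMn (a i) (ht i); rewrite mul1n.
Qed.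

Lemma exp_homog d v : (d`!%:R)^-1 *: linform v ^+ d \is d.-homog.
Proof.
by apply/rpredZ; have := dhomogMn d (linform_homog v); rewrite mul1n.
Qed.

End Homogeneous.

(* C[[V]] for V = C^N, realized as the product of the symmetric powers S^d(V):
   a formal power series in the basis vectors eps_1, ..., eps_N (the variables
   'X_i) is the sequence of its homogeneous components, the coefficient of the
   monomial a being (f (mdeg a))@_a. *)
Record fps (C : fieldType) (N : nat) := FPS {
  fcomp :> nat -> {mpoly C[N]};
  fcompP : forall d, fcomp d \is d.-homog }.

Section FpsRing.
Context (C : fieldType) (N : nat).
Local Notation S := (fps C N).
Implicit Types (f g h : S).

HB.instance Definition _ := gen_eqMixin S.
HB.instance Definition _ := gen_choiceMixin S.

Lemma fpsP f g : (forall d, f d = g d) <-> f = g.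
Proof.
split=> [|-> //]; case: f g => [f hf] [g hg] /= /funext E; subst g.
by congr FPS; apply: Prop_irrelevance.
Qed.

Definition fzero : S := FPS (fun d => rpred0 _ : 0 \is d.-homog).
Definition fopp f : S := FPS (fun d => rpredNr (fcompP f d)).
Definition fadd f g : S := FPS (fun d => rpredD (fcompP f d) (fcompP g d)).

Lemma faddA : associative fadd.
Proof. by move=> f g h; apply/fpsP => d /=; rewrite addrA. Qed.
Lemma faddC : commutative fadd.
Proof. by move=> f g; apply/fpsP => d /=; rewrite addrC. Qed.
Lemma fadd0 : left_id fzero fadd.
Proof. by move=> f; apply/fpsP => d /=; rewrite add0r. Qed.
Lemma faddN : left_inverse fzero fopp fadd.
Proof. by move=> f; apply/fpsP => d /=; rewrite addNr. Qed.

HB.instance Definition _ := GRing.isZmodule.Build S faddA faddC fadd0 faddN.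

Lemma fscaleP (c : C) f d : c *: f d \is d.-homog.
Proof. exact/rpredZ/fcompP. Qed.
Definition fscale c f : S := FPS (fscaleP c f).

Lemma fscaleA a b f : fscale a (fscale b f) = fscale (a * b) f.
Proof. by apply/fpsP => d /=; rewrite scalerA. Qed.
Lemma fscale1 : left_id 1 fscale.
Proof. by move=> f; apply/fpsP => d /=; rewrite scale1r. Qed.
Lemma fscaleDr : right_distributive fscale +%R.
Proof. by move=> a f g; apply/fpsP => d /=; rewrite scalerDr. Qed.
Lemma fscaleDl f : {morph fscale^~ f : a b / a + b}.
Proof. by move=> a b; apply/fpsP => d /=; rewrite scalerDl. Qed.

HB.instance Definition _ :=
  GRing.Zmodule_isLmodule.Build C S fscaleA fscale1 fscaleDr fscaleDl.

Lemma foneP d : (d == 0)%N%:R \is [in C[N], d.-homog].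
Proof. by case: d => [|d]; [exact: dhomog1 | exact: rpred0]. Qed.
Definition fone : S := FPS foneP.

Lemma fmulP f g d : \sum_(i < d.+1) f i * g (d - i)%N \is d.-homog.
Proof.
apply/rpred_sum => i _; have := dhomogM (fcompP f i) (fcompP g (d - i)%N).
by rewrite subnKC // leq_ord.
Qed.
Definition fmul f g : S := FPS (fmulP f g).

Definition ftrunc k f : {poly {mpoly C[N]}} := \poly_(i < k) f i.

Lemma coef_ftrunc k f i : (i < k)%N -> (ftrunc k f)`_i = f i.
Proof. by rewrite coef_poly => ->. Qed.

Lemma coef_ftruncM k f g i :
  (i < k)%N -> (ftrunc k f * ftrunc k g)`_i = fmul f g i.
Proof.
move=> ik; rewrite coefM /=; apply: eq_bigr => j _.
have jk : (j < k)%N by apply: leq_ltn_trans ik; rewrite -ltnS.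
by rewrite !coef_ftrunc // (leq_ltn_trans (leq_subr _ _)).
Qed.

Lemma fmulC : commutative fmul.
Proof.
by move=> f g; apply/fpsP => d; rewrite -!(coef_ftruncM _ _ (ltnSn d)) mulrC.
Qed.

Lemma fmulA : associative fmul.
Proof.
move=> f g h; apply/fpsP => d; pose T := ftrunc d.+1.
have E f' g' i : (i < d.+1)%N -> (T (fmul f' g'))`_i = (T f' * T g')`_i.
  by move=> id; rewrite coef_ftruncM // coef_ftrunc.
rewrite -!(coef_ftruncM _ _ (ltnSn d)) -/T.
have -> : (T f * T (fmul g h))`_d = (T f * (T g * T h))`_d.
  rewrite !(coefM _ _ d); apply: eq_bigr => j _; rewrite E //.
  by rewrite ltnS leq_subr.
rewrite mulrA !(coefM _ _ d); apply: eq_bigr => j _; rewrite E //.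
Qed.

Lemma fmul1 : left_id fone fmul.
Proof.
move=> f; apply/fpsP => d /=; rewrite big_ord_recl /= subn0 mul1r big1 ?addr0 //.
by move=> i _; rewrite mul0r.
Qed.

Lemma fmulDl : left_distributive fmul +%R.
Proof.
move=> f g h; apply/fpsP => d /=; rewrite -big_split /=.
by apply: eq_bigr => i _; rewrite mulrDl.
Qed.

Lemma fone_neq0 : fone != 0.
Proof. by apply/eqP => /fpsP/(_ 0%N)/eqP /=; rewrite oner_eq0. Qed.

HB.instance Definition _ :=
  GRing.Zmodule_isComNzRing.Build S fmulA fmulC fmul1 fmulDl fone_neq0.

Lemma fscaleAl (c : C) f g : c *: (f * g) = c *: f * g.
Proof.
apply/fpsP => d /=; rewrite scaler_sumr.
by apply: eq_bigr => i _; rewrite scalerAl.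
Qed.

HB.instance Definition _ := GRing.Lmodule_isLalgebra.Build C S fscaleAl.
HB.instance Definition _ := GRing.Lalgebra_isComAlgebra.Build C S.

Definition funit : pred S := fun f => `[< exists g, g * f = 1 >].
Definition finv f : S :=
  if pselect (exists g, g * f = 1) is left e then projT1 (cid e) else f.

Lemma fmulV : {in funit, left_inverse 1 finv *%R}.
Proof.
by move=> f /asboolP e; rewrite /finv; case: pselect => // e'; case: cid.
Qed.
Lemma funitP f g : g * f = 1 -> funit f.
Proof. by move=> e; apply/asboolP; exists g. Qed.
Lemma finv_out : {in [predC funit], finv =1 id}.
Proof. by move=> f /asboolP e; rewrite /finv; case: pselect. Qed.

HB.instance Definition _ :=
  GRing.ComNzRing_hasMulInverse.Build S fmulV funitP finv_out.

Lemma fps_lowest f :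
  f != 0 -> exists2 d, f d != 0 & forall i, (i < d)%N -> f i = 0.
Proof.
move=> f0; have ex : exists d, f d != 0.
  apply: contrapT => h; move/eqP: f0; apply; apply/fpsP => d /=.
  by apply: contrapT => /eqP hd; apply: h; exists d.
case: (ex_minnP ex) => d fd dmin; exists d => // i id.
by apply/eqP; apply: contraLR id => /dmin; rewrite -leqNgt.
Qed.

Lemma fps_integral f g : f * g = 0 -> (f == 0) || (g == 0).
Proof.
move=> fg; apply: contrapT => /negP; rewrite negb_or => /andP[].
move=> /fps_lowest [a fa amin] /fps_lowest [b gb bmin].
have /eqP := (fpsP (f * g) 0).2 fg (a + b)%N; apply/negP => /=.
rewrite (bigD1 (Ordinal (leq_addr b a : (a < (a + b).+1)%N))) //= addKn big1.
  by rewrite addr0 mulf_neq0.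
move=> i; rewrite -val_eqE /= => ia; case: (ltngtP i a) ia => // ia _.
  by rewrite amin // mul0r.
by rewrite bmin ?mulr0 // ltn_subLR ?ltn_add2r // -ltnS.
Qed.

HB.instance Definition _ := GRing.ComUnitRing_isIntegral.Build S fps_integral.

End FpsRing.

(* Frac(C[[V]]), as a C-vector space. It contains the field C(x_1, ..., x_N) of
   rational functions in the x_i = e^(eps_i), in which the entries of the Moser
   matrix live. *)
Definition fpsfrac (C : fieldType) (N : nat) : Type := {fraction fps C N}.
HB.instance Definition _ (C : fieldType) (N : nat) :=
  GRing.Field.copy (fpsfrac C N) {fraction fps C N}.

Section FpsFrac.
Context (C : fieldType) (N : nat).
Local Notation K := (fpsfrac C N).

Definition tofps : fps C N -> K := @FracField.tofrac (fps C N).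

Lemma tofps_is_zmod_morphism : zmod_morphism tofps.
Proof. exact: tofracB. Qed.
Lemma tofps_is_monoid_morphism : monoid_morphism tofps.
Proof. exact: tofrac_is_monoid_morphism. Qed.
HB.instance Definition _ :=
  GRing.isZmodMorphism.Build (fps C N) K tofps tofps_is_zmod_morphism.
HB.instance Definition _ :=
  GRing.isMonoidMorphism.Build (fps C N) K tofps tofps_is_monoid_morphism.

Definition fracscale (c : C) (x : K) : K := tofps (c%:A) * x.

Lemma fracscaleA a b x : fracscale a (fracscale b x) = fracscale (a * b) x.
Proof. by rewrite /fracscale mulrA -rmorphM -scalerAl mul1r scalerA. Qed.
Lemma fracscale1 : left_id 1 fracscale.
Proof. by move=> x; rewrite /fracscale scale1r rmorph1 mul1r. Qed.
Lemma fracscaleDr : right_distributive fracscale +%R.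
Proof. by move=> a x y; rewrite /fracscale mulrDr. Qed.
Lemma fracscaleDl x : {morph fracscale^~ x : a b / a + b}.
Proof. by move=> a b; rewrite /fracscale scalerDl rmorphD mulrDl. Qed.

HB.instance Definition _ :=
  GRing.Zmodule_isLmodule.Build C K fracscaleA fracscale1 fracscaleDr fracscaleDl.

End FpsFrac.

Section Series.
Context (C : fieldType) (N : nat).
Implicit Types (f : fps C N) (u v : 'rV[C]_N).

Definition eps (i : 'I_N) : 'rV[C]_N := delta_mx 0 i.

Lemma fvecP v d : (if d == 1 then linform v else 0) \is d.-homog.
Proof. by case: eqP => [->|_]; [exact: linform_homog | exact: rpred0]. Qed.
Definition fvec v : fps C N := FPS (fvecP v).

(* e^v = \sum_d v^d / d! *)
Definition fexp v : fps C N := FPS (fun d => exp_homog d v).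

(* The action on C[[V]] of a linear map g : V -> V, i.e. the substitution
   eps_i := g eps_i. *)
Lemma fps_actP (g : 'rV[C]_N -> 'rV[C]_N) f d :
  f d \mPo [tuple linform (g (eps i)) | i < N] \is d.-homog.
Proof.
apply: comp_homog (fcompP f d) => i.
by rewrite tnth_mktuple; apply: linform_homog.
Qed.
Definition fps_act g f : fps C N := FPS (fps_actP g f).

(* The partial derivative with respect to the variable eps_i; it lowers degrees
   by one. *)
Lemma fderivP i f d : (f d.+1)^`M(i) \is d.-homog.
Proof. exact/mderiv_homog/fcompP. Qed.
Definition fderiv i f : fps C N := FPS (fderivP i f).

Lemma fps_actM (g : 'rV[C]_N -> 'rV[C]_N) : {morph fps_act g : f1 f2 / f1 * f2}.
Proof.
move=> f1 f2; apply/fpsP => d /=; rewrite linear_sum.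
by apply: eq_bigr => i _; rewrite rmorphM.
Qed.

Lemma fps_act_fvec (g : {linear 'rV[C]_N -> 'rV[C]_N}) v :
  fps_act g (fvec v) = fvec (g v).
Proof.
apply/fpsP => d /=; case: eqP => _; last by rewrite linear0.
rewrite {1}/linform linear_sum /= {2}[v]row_sum_delta linear_sum /=.
have -> (F : 'I_N -> 'rV[C]_N) : linform (\sum_i F i) = \sum_i linform (F i).
  rewrite /linform exchange_big /=; apply: eq_bigr => j _.
  by rewrite summxE scaler_suml.
apply: eq_bigr => i _; rewrite comp_mpolyZ comp_mpolyXU -tnth_nth tnth_mktuple.
by rewrite linearZ /= -[_ *: g _]addr0 linformP [linform 0]big1 ?addr0 // => j _;
   rewrite mxE scale0r.
Qed.

Lemma fps_act_fexp (g : {linear 'rV[C]_N -> 'rV[C]_N}) v :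
  fps_act g (fexp v) = fexp (g v).
Proof.
apply/fpsP => d /=; rewrite comp_mpolyZ rmorphXn /=.
by have /fpsP/(_ 1) /= -> := fps_act_fvec g v.
Qed.

Lemma fderivM i f1 f2 : fderiv i (f1 * f2) = fderiv i f1 * f2 + f1 * fderiv i f2.
Proof.
apply/fpsP => d /=; rewrite linear_sum /=.
under eq_bigr do rewrite mderivM.
rewrite big_split /=; congr (_ + _).
  rewrite big_ord_recl /=.
  have -> : (f1 0%N)^`M(i) = 0.
    apply/mpolyP => a; rewrite mcoeff_mderiv mcoeff0.
    rewrite (dhomog_nemf_coeff (fcompP f1 0)) ?mul0rn //=.
    by rewrite mdegD mdeg1 addn1.
  by rewrite mul0r add0r.
rewrite big_ord_recr /= subnn.
have -> : (f2 0%N)^`M(i) = 0.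
  apply/mpolyP => a; rewrite mcoeff_mderiv mcoeff0.
  rewrite (dhomog_nemf_coeff (fcompP f2 0)) ?mul0rn //=.
  by rewrite mdegD mdeg1 addn1.
rewrite mulr0 addr0; apply: eq_bigr => j _.
by rewrite subSn // leq_ord.
Qed.

Lemma fderiv_fvec i v : fderiv i (fvec v) = (v 0 i)%:A.
Proof.
apply/fpsP => -[|d] /=; last by rewrite linear0 scaler0.
rewrite /linform linear_sum (bigD1 i) //= big1 => [|j ji].
  rewrite addr0 mderivZ mderivX mnm1E eqxx scale1r.
  by have -> : (U_(i) - U_(i) = 0)%MM; [apply/mnmP => j; rewrite mnmBE subnn mnm0E | rewrite mpolyX0].
by rewrite mderivZ mderivX mnm1E (negPf ji) scale0r scaler0.
Qed.

(* The span of the e^v for v with integer coordinates. *)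
Definition in_hatS f : Prop :=
  exists s : seq (C * 'rV[int]_N),
    f = \sum_(t <- s) t.1 *: fexp (map_mx intr t.2).

Definition in_ideal (a f : fps C N) : Prop := exists h, f = h * a.

End Series.

Section Super.
Context (C : fieldType) (n m : nat) (k : C).
Local Notation V := 'rV[C]_(n + m).
Local Notation S := (fps C (n + m)).
Local Notation K := (fpsfrac C (n + m)).
Implicit Types (u v alpha : V) (i j : 'I_(n + m)).

(* Indices start at 0: eps_1, ..., eps_n are the even basis vectors eps i with
   i < n. *)
Definition parity i : nat := (n <= i)%N.

Definition bform u v : C := \sum_i k ^+ parity i * (u 0 i * v 0 i).

Definition odd_root alpha : Prop :=
  exists i j, [/\ i != j, odd (parity i + parity j) & alpha = eps C i - eps C j].

Definition reflection alpha v : V :=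
  v - (2 * bform v alpha / bform alpha alpha) *: alpha.

(* The action of S_n x S_m, the group generated by the reflections in the even
   roots. *)
Definition permV (sigma : 'S_n) (tau : 'S_m) v : V :=
  v *m block_mx (perm_mx sigma) 0 0 (perm_mx tau).

Lemma permV_lshift (sigma : 'S_n) (tau : 'S_m) (i : 'I_n) :
  permV sigma tau (eps C (lshift m i)) = eps C (lshift m (sigma i)).
Proof.
apply/rowP => j; rewrite /permV /eps -rowE [LHS]mxE.
case: (split_ordP j) => l ->; rewrite ?block_mxEul ?block_mxEur !mxE.
all: rewrite ?eq_lshift ?eq_rlshift ?eq_lrshift ?andbF //= 1?eq_sym //.
Qed.

Lemma permV_rshift (sigma : 'S_n) (tau : 'S_m) (j : 'I_m) :
  permV sigma tau (eps C (rshift n j)) = eps C (rshift n (tau j)).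
Proof.
apply/rowP => l; rewrite /permV /eps -rowE [LHS]mxE.
case: (split_ordP l) => l' ->; rewrite ?block_mxEdl ?block_mxEdr !mxE.
all: rewrite ?eq_rshift ?eq_lrshift ?eq_rlshift ?andbF //= 1?eq_sym //.
Qed.

Definition quasi_hom (phi : {linear V -> S}) : Prop :=
  (forall sigma tau v,
     phi (permV sigma tau v) = fps_act (permV sigma tau) (phi v)) /\
  (forall alpha v, odd_root alpha ->
     in_ideal (fvec alpha ^+ 2)
       (fps_act (reflection alpha) (phi v) - phi (reflection alpha v))).

Definition quasi_hom_hatS (phi : {linear V -> S}) : Prop :=
  quasi_hom phi /\ forall v, in_hatS (phi v).

(* The derivation of C[[V]] extending u |-> (v, u); see dV_fvec and dVM. *)
Definition dV v (f : S) : S := \sum_i bform v (eps C i) *: fderiv i f.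

Lemma dV_fvec v u : dV v (fvec u) = (bform v u)%:A.
Proof.
rewrite /dV; under eq_bigr do rewrite fderiv_fvec scalerA.
rewrite -scaler_suml; congr (_ *: _); apply: eq_bigr => i _.
rewrite /bform (bigD1 i) //= big1 => [|j ji]; rewrite !mxE ?eqxx.
  by rewrite addr0 mulr1 mulrA.
by rewrite (negPf ji) andbF !mulr0.
Qed.

Lemma dVM v f1 f2 : dV v (f1 * f2) = dV v f1 * f2 + f1 * dV v f2.
Proof.
rewrite /dV mulr_suml mulr_sumr -big_split /=; apply: eq_bigr => i _.
by rewrite fderivM scalerDr scalerAl scalerAr.
Qed.

Definition xfrac i : K := tofps (fexp (eps C i)).

(* The entries L_(i, j), as operators C[[V]] -> Frac(C[[V]]). *)
Definition moser i j (f : S) : K :=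
  if i == j then
    tofps (dV (eps C i) f)
    - \sum_(l | l != i)
        k ^+ (1 - parity l) *: (xfrac i / (xfrac i - xfrac l) * tofps f)
  else k ^+ (1 - parity j) *: (xfrac i / (xfrac i - xfrac j) * tofps f).

End Super.

(* Main.v *)
(* Write f_i = phi(eps_i) and x_i = e^(eps_i). Then
     psi(eps_i) = d_i f_i - sum_(l <> i) k^(1 - p(l)) x_i G_il
   with (x_i - x_l) G_il = f_i - f_l. Quasi-invariance of phi puts f_i - f_l in
   the ideal (eps_i - eps_l) of C[[V]]. Setting eps_i := eps_l then kills
   f_i - f_l, and as e^v differs from its image under this substitution by a
   multiple of x_i - x_l in \hat S(V), G_il lies in \hat S(V).

   For an odd root alpha = eps_i - eps_j with i even, V is the span of alpha and
   of the vectors orthogonal to it: the eps_l, l <> i, j, and k eps_i + eps_j.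
   So the condition at alpha amounts to: f_i - f_j is in (alpha), and the f_l
   and k f_i + f_j are s_alpha-invariant modulo alpha^2. These properties pass
   to psi because s_alpha commutes with the derivations along vectors orthogonal
   to alpha and anticommutes with the one along alpha. *)
Require Import Defs.
From HB Require Import structures.
From mathcomp Require Import all_boot all_order all_fingroup all_algebra.
From mathcomp Require Import fraction mpoly complex.
From mathcomp Require Import boolp reals ring.
Set Implicit Arguments.
Unset Strict Implicit.
Unset Printing Implicit Defensive.
Import GRing.Theory Num.Theory.
Local Open Scope ring_scope.

(** * Linear forms attached to vectors *)

Section LinearForms.
Context (C : fieldType) (N : nat).
Implicit Types (u v : 'rV[C]_N).

Lemma linform0 : linform (0 : 'rV[C]_N) = 0.
Proof. by rewrite /linform big1 // => i _; rewrite mxE scale0r. Qed.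

Lemma linformD u v : linform (u + v) = linform u + linform v.
Proof. by have := linformP 1 u v; rewrite !scale1r. Qed.

Lemma linformZ c v : linform (c *: v) = c *: linform v.
Proof. by have := linformP c v 0; rewrite addr0 linform0 addr0. Qed.

Lemma linform_eps i : linform (eps C i) = 'X_i :> {mpoly C[N]}.
Proof.
rewrite /linform (bigD1 i) //= big1 => [|j ji]; rewrite !mxE ?eqxx.
  by rewrite scale1r addr0.
by rewrite (negPf ji) andbF scale0r.
Qed.

Lemma linform_inj : injective (@linform C N).
Proof.
move=> u v uv; apply/rowP => i; have := congr1 (mcoeff U_(i)) uv.
have E (w : 'rV[C]_N) : (linform w)@_(U_(i)) = w 0 i.
  rewrite /linform raddf_sum (bigD1 i) //= big1 => [|j ji].
    by rewrite mcoeffZ mcoeffX eqxx mulr1 addr0.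
  rewrite mcoeffZ mcoeffX; case: eqP => [/mnmP/(_ j)|_]; last by rewrite mulr0.
  by rewrite !mnm1E eqxx eq_sym (negPf ji).
by rewrite !E.
Qed.

End LinearForms.

(** * Substitutions and partial derivatives in C[[V]] *)

Section FormalSeries.
Context (C : fieldType) (N : nat).
Local Notation V := 'rV[C]_N.
Local Notation S := (fps C N).
Implicit Types (f : S) (u v : V).

Lemma fvecZ c v : fvec (c *: v) = c *: fvec v :> S.
Proof. by apply/fpsP => d /=; case: eqP; rewrite ?scaler0 ?linformZ. Qed.

Lemma fvecN v : fvec (- v) = - fvec v :> S.
Proof. by rewrite -scaleN1r fvecZ scaleN1r. Qed.

Lemma fvec0 : fvec 0 = 0 :> S.
Proof. by rewrite -(scale0r 0) fvecZ scale0r. Qed.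

Lemma fvec_neq0 v : v != 0 -> fvec v != 0 :> S.
Proof.
apply: contraNneq => /fpsP/(_ 1) /=; rewrite -linform0.
by move=> /linform_inj ->.
Qed.

Lemma fps_act_is_zmod_morphism (g : V -> V) : zmod_morphism (fps_act g).
Proof. by move=> f1 f2; apply/fpsP => d /=; rewrite raddfB. Qed.

Lemma fps_act_is_monoid_morphism (g : V -> V) : monoid_morphism (fps_act g).
Proof.
split; last exact: fps_actM.
by apply/fpsP => -[|d] /=; rewrite ?rmorph1 ?rmorph0.
Qed.

Lemma fps_act_is_scalable (g : V -> V) : scalable (fps_act g).
Proof. by move=> c f; apply/fpsP => d /=; rewrite linearZ. Qed.

HB.instance Definition _ g :=
  GRing.isZmodMorphism.Build S S (fps_act g) (fps_act_is_zmod_morphism g).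
HB.instance Definition _ g :=
  GRing.isMonoidMorphism.Build S S (fps_act g) (fps_act_is_monoid_morphism g).
HB.instance Definition _ g :=
  GRing.isScalable.Build C S S *:%R (fps_act g) (fps_act_is_scalable g).

Lemma eq_fps_act (g h : V -> V) : g =1 h -> fps_act g =1 fps_act h.
Proof.
move=> gh f; apply/fpsP => d /=; congr (_ \mPo _).
by apply: eq_from_tnth => i; rewrite !tnth_mktuple gh.
Qed.

Lemma fderiv_is_linear i : linear (@fderiv C N i).
Proof. by move=> c f1 f2; apply/fpsP => d /=; rewrite linearP. Qed.
HB.instance Definition _ i :=
  GRing.isLinear.Build C S S *:%R (@fderiv C N i) (fderiv_is_linear i).

(** Chain rule. Both sides are linear in [p]; for a monomial, Leibniz peels off one variable at a
    time, by induction on the degree. *)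
Lemma mderiv_comp (p : {mpoly C[N]}) (t : N.-tuple {mpoly C[N]}) i :
  (p \mPo t)^`M(i) = \sum_j (tnth t j)^`M(i) * (p^`M(j) \mPo t).
Proof.
elim/mpolyind: p => [|c a p _ _ IH].
  by rewrite !linear0 big1 // => j _; rewrite !linear0 mulr0.
have -> : \sum_j (tnth t j)^`M(i) * ((c *: 'X_[a] + p)^`M(j) \mPo t) =
    c *: (\sum_j (tnth t j)^`M(i) * ('X_[a]^`M(j) \mPo t)) +
    \sum_j (tnth t j)^`M(i) * (p^`M(j) \mPo t).
  rewrite scaler_sumr -big_split /=; apply: eq_bigr => j _.
  by rewrite !linearP /= mulrDr scalerAr.
rewrite !linearP /= IH; congr (_ *: _ + _) => {IH p c}.
have [n] := ubnP (mdeg a); elim: n a => // n IH a.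
have [->|a0] := eqVneq a 0%MM.
  move=> _; rewrite mpolyX0 comp_mpoly1 -mpolyC1 mderivC big1 // => j _.
  by rewrite mderivC raddf0 mulr0.
have [l al] : exists l, a l != 0%N.
  apply/existsP; rewrite -negb_forall; apply: contra a0 => /forallP h.
  by apply/eqP/mnmP => l; rewrite mnm0E; apply/eqP.
have -> : a = (U_(l) + (a - U_(l)))%MM by rewrite addmC submK // lep1mP.
set b := (a - U_(l))%MM; rewrite mdegD mdeg1 add1n ltnS => /IH E.
rewrite mpolyXD rmorphM mderivM E /= comp_mpolyXU -tnth_nth.
under [RHS]eq_bigr do rewrite mderivM rmorphD !rmorphM /= mulrDr.
rewrite big_split /=; congr (_ + _); last first.
  rewrite mulr_sumr; apply: eq_bigr => j _.
  by rewrite comp_mpolyXU -tnth_nth mulrCA.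
rewrite (bigD1 l) //= big1 ?addr0 => [|j jl].
  have -> : ('X_l : {mpoly C[N]})^`M(l) = 1.
    rewrite mderivX mnm1E eqxx scale1r -[RHS]mpolyX0; congr 'X_[_].
    by apply/mnmP => j; rewrite mnmBE subnn mnm0E.
  by rewrite comp_mpoly1 mul1r.
by rewrite mderivX mnm1E eq_sym (negPf jl) scale0r raddf0 mul0r mulr0.
Qed.

Lemma fderiv_act (g : V -> V) i f :
  fderiv i (fps_act g f) = \sum_j g (eps C j) 0 i *: fps_act g (fderiv j f).
Proof.
have E : fcomp (\sum_j g (eps C j) 0 i *: fps_act g (fderiv j f)) =1
    fun d => \sum_j g (eps C j) 0 i *: fps_act g (fderiv j f) d.
  by move=> d; elim/big_rec2: _ => //= j p q _ <-.
apply/fpsP => d; rewrite E /= mderiv_comp; apply: eq_bigr => j _.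
(* The inner derivative is that of a linear form, hence a constant, read off in degree 0. *)
rewrite tnth_mktuple; have /fpsP/(_ 0%N)/= := fderiv_fvec i (g (eps C j)).
by move=> ->; rewrite -scalerAl mul1r.
Qed.

End FormalSeries.

(** * Ideals of C[[V]] and substitutions congruent to the identity *)

Section Ideals.
Context (C : fieldType) (N : nat).
Local Notation V := 'rV[C]_N.
Local Notation S := (fps C N).
Implicit Types (a f g : S).

Lemma in_ideal0 a : in_ideal a 0.
Proof. by exists 0; rewrite mul0r. Qed.

Lemma in_idealD a f g : in_ideal a f -> in_ideal a g -> in_ideal a (f + g).
Proof. by move=> [u ->] [v ->]; exists (u + v); rewrite mulrDl. Qed.

Lemma in_idealM a f g : in_ideal a g -> in_ideal a (f * g).
Proof. by move=> [v ->]; exists (f * v); rewrite mulrA. Qed.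

Lemma in_idealMr a f g : in_ideal a f -> in_ideal a (f * g).
Proof. by rewrite mulrC; apply: in_idealM. Qed.

Lemma in_idealN a f : in_ideal a f -> in_ideal a (- f).
Proof. by move=> [v ->]; exists (- v); rewrite mulNr. Qed.

Lemma in_idealB a f g : in_ideal a f -> in_ideal a g -> in_ideal a (f - g).
Proof. by move=> hf /in_idealN; apply: in_idealD. Qed.

Lemma in_idealZ a c f : in_ideal a f -> in_ideal a (c *: f).
Proof. by move=> [v ->]; exists (c *: v); rewrite scalerAl. Qed.

Lemma in_ideal_sum a (I : Type) (r : seq I) (P : pred I) (F : I -> S) :
  (forall i, P i -> in_ideal a (F i)) -> in_ideal a (\sum_(i <- r | P i) F i).
Proof.
move=> h; elim/big_rec: _ => [|i f Pi]; first exact: in_ideal0.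
by apply: in_idealD; apply: h.
Qed.

Lemma in_ideal_sqr a f : in_ideal (a ^+ 2) f -> in_ideal a f.
Proof. by move=> [v ->]; exists (v * a); rewrite expr2 mulrA. Qed.

Lemma in_ideal_scale a c f : c != 0 -> in_ideal a (c *: f) -> in_ideal a f.
Proof.
by move=> c0 /(@in_idealZ _ c^-1); rewrite scalerA mulVf // scale1r.
Qed.

(** Each variable moves by a multiple of [w], and congruence modulo [w] is compatible with sums and
    products. *)
Lemma mpoly_comp_sub (w : V) (t : N.-tuple {mpoly C[N]}) (c : 'I_N -> C) p :
  (forall i, tnth t i = 'X_i + c i *: linform w) ->
  exists q, p \mPo t - p = q * linform w.
Proof.
move=> tE; elim/mpolyind: p => [|b a p _ _ [q hq]].
  by exists 0; rewrite linear0 subr0 mul0r.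
suff [r hr] : exists r, 'X_[a] \mPo t - 'X_[a] = r * linform w.
  exists (b *: r + q).
  by rewrite linearP /= mulrDl -hq -scalerAl -hr scalerBr opprD addrACA.
rewrite comp_mpolyX mpolyXE_id; elim/big_rec2: _ => [|i x y _ [r hr]].
  by exists 0; rewrite subrr mul0r.
have [s hs] : exists s, tnth t i ^+ a i - 'X_i ^+ a i = s * linform w.
  rewrite subrXX tE addrAC subrr add0r -scalerAl scalerAr mulrC.
  by eexists.
(* The difference of the two products is split by changing one factor at a time. *)
exists (s * y + 'X_i ^+ a i * r).
by rewrite mulrDl mulrAC -hs -mulrA -hr; ring.
Qed.

(** Multiplication by a linear form raises every degree by exactly one, so the homogeneous
    components of [q] do not mix. *)
Lemma pihomog_mul_linform d (w : V) (q : {mpoly C[N]}) :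
  pihomog mdeg d (q * linform w) =
  if d is d'.+1 then pihomog mdeg d' q * linform w else 0.
Proof.
rewrite {1}(@pihomog_partitionE _ _ mdeg _ q (leq_maxr d _)).
set K := maxn _ _; rewrite mulr_suml linear_sum /=.
have hom (i : nat) : pihomog mdeg i q * linform w \is i.+1.-homog.
  by rewrite -addn1; apply: dhomogM (pihomogP _ _ _) (linform_homog w).
case: d @K => [|d] K.
  by rewrite big1 // => i _; apply: (@pihomog_ne0 _ _ _ i.+1).
have dK : (d < K)%N by rewrite leq_maxl.
rewrite (bigD1 (Ordinal dK)) //= big1 => [|i].
  by rewrite addr0 pihomog_dE.
by rewrite -val_eqE /= => id'; apply: (@pihomog_ne0 _ _ _ i.+1).
Qed.

(* Degree by degree, [mpoly_comp_sub] gives a quotient that need not be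
   homogeneous; its component of the right degree is also a quotient. *)
Lemma fps_act_sub (g : V -> V) (w : V) (c : 'I_N -> C) f :
  (forall i, g (eps C i) = eps C i + c i *: w) ->
  in_ideal (fvec w) (fps_act g f - f).
Proof.
move=> gE; pose t := [tuple linform (g (eps C i)) | i < N].
have tE i : tnth t i = 'X_i + c i *: linform w.
  by rewrite tnth_mktuple gE linformD linformZ linform_eps.
have /choice[q hq] d := mpoly_comp_sub (f d) tE.
have L1 := linform_homog w.
have qP d : pihomog mdeg d (q d.+1) \is d.-homog by apply: pihomogP.
have hd d : f d \mPo t - f d = pihomog mdeg d (q d * linform w).
  rewrite -hq pihomog_dE //; apply: rpredB; last exact: fcompP.
  by apply: comp_homog (fcompP f _) => i; rewrite tnth_mktuple linform_homog.
exists (FPS qP); apply/fpsP => d /=; rewrite hd pihomog_mul_linform.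
case: d => [|d]; first by rewrite big_ord1 subnn /= mulr0.
(* [fvec w] is concentrated in degree 1, so only the term [i = d] of the product survives. *)
rewrite big_ord_recr /= subnn /= mulr0 addr0 big_ord_recr /= subSn // subnn /=.
rewrite big1 ?add0r // => i _.
by rewrite subSn ?(ltnW (ltn_ord i)) //= eqSS subn_eq0 leqNgt ltn_ord mulr0.
Qed.

End Ideals.

(** * Projection along a vector and primality of the ideal (w) *)

Section Collapse.
Context (C : fieldType) (N : nat).
Local Notation V := 'rV[C]_N.
Local Notation S := (fps C N).
Implicit Types (f g : S).

(** When [w 0 i = 1], this is the projection along [w] onto the hyperplane where coordinate [i]
    vanishes. For [w = eps i - eps j] with [i != j] it is the substitution eps_i := eps_j. *)
Definition collapse i (w v : V) : V := v - v 0 i *: w.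

Lemma collapse_is_linear i w : linear (collapse i w).
Proof.
move=> a u v; rewrite /collapse !mxE scalerDl -scalerA scalerBr opprD.
by rewrite addrACA.
Qed.
HB.instance Definition _ i w :=
  GRing.isLinear.Build C V V *:%R (collapse i w) (collapse_is_linear i w).

Lemma collapse_self i (w : V) : w 0 i = 1 -> collapse i w w = 0.
Proof. by rewrite /collapse => ->; rewrite scale1r subrr. Qed.

(* So C[[V]]/(w) embeds in C[[V]], and the ideal (w) is prime. *)
Lemma in_ideal_collapse i (w : V) f : w 0 i = 1 ->
  in_ideal (fvec w) f <-> fps_act (collapse i w) f = 0.
Proof.
move=> wi; split=> [[h ->]|hf].
  by rewrite rmorphM /= fps_act_fvec /= collapse_self // fvec0 mulr0.
rewrite -[f]opprK; apply: in_idealN; rewrite -[- f]add0r -{1}hf.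
apply: (@fps_act_sub _ _ _ _ (fun j => - eps C j 0 i)) => j.
by rewrite /collapse scaleNr.
Qed.

Lemma in_ideal_prime i (w : V) f g : w 0 i = 1 ->
  in_ideal (fvec w) (f * g) -> ~ in_ideal (fvec w) f -> in_ideal (fvec w) g.
Proof.
move=> wi; rewrite !(in_ideal_collapse _ wi) rmorphM /= => /eqP.
by rewrite mulf_eq0 => /orP[/eqP -> //|/eqP].
Qed.

(** The ideal (w^2) is (w)-primary: [w] divides [g] by primality, and after cancelling one [w] it
    divides the quotient [h] as well. *)
Lemma in_ideal_sqr_prime i (w : V) f g : w 0 i = 1 ->
  in_ideal (fvec w ^+ 2) (f * g) -> ~ in_ideal (fvec w) f ->
  in_ideal (fvec w ^+ 2) g.
Proof.
move=> wi fg nf; have [h hg] := in_ideal_prime wi (in_ideal_sqr fg) nf.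
have w0 : fvec w != 0 :> S.
  apply/fvec_neq0/eqP => w0; move: wi; rewrite w0 mxE => /eqP.
  by rewrite eq_sym oner_eq0.
have [|u hu] := @in_ideal_prime i w f h wi _ nf; last first.
  by exists u; rewrite hg hu expr2 mulrA.
have [v hv] := fg; exists v; apply: (mulIf w0).
by rewrite -mulrA -hg hv expr2 mulrA.
Qed.

End Collapse.

(** * Exponentials and division in \hat S(V) *)

Section Exponentials.
Context (C : numFieldType) (N : nat).
Local Notation V := 'rV[C]_N.
Local Notation S := (fps C N).
Implicit Types (f g : S) (u v : V).

Lemma fexp0 : fexp 0 = 1 :> S.
Proof.
apply/fpsP => -[|d] /=; first by rewrite expr0 fact0 invr1 scale1r.
by rewrite linform0 expr0n /= scaler0.
Qed.

(** In each degree this is the binomial formula, the factorials absorbing the binomial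
    coefficients. *)
Lemma fexpD u v : fexp (u + v) = fexp u * fexp v :> S.
Proof.
apply/fpsP => d /=; rewrite linformD addrC exprDn scaler_sumr.
apply: eq_bigr => i _; rewrite -scalerAl -scalerAr scalerA.
rewrite [linform v ^+ _ * _]mulrC -scaler_nat scalerA; congr (_ *: _).
have fact_neq0 n : n`!%:R != 0 :> C by rewrite pnatr_eq0 -lt0n fact_gt0.
have id' : (i <= d)%N by rewrite -ltnS.
apply: (mulfI (fact_neq0 d)); rewrite mulrA mulfV // mul1r.
rewrite -(bin_fact id') !natrM.
by field; rewrite !fact_neq0.
Qed.

Lemma fexpN v : fexp (- v) * fexp v = 1 :> S.
Proof. by rewrite -fexpD addNr fexp0. Qed.

(** The degree 1 component of e^v is the linear form of [v]. *)
Lemma fexp_inj : injective (@fexp C N).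
Proof.
move=> u v /fpsP/(_ 1) /=; rewrite (_ : 1`! = 1%N) // invr1 !scale1r !expr1.
exact: linform_inj.
Qed.

Lemma fderiv_fexp i v : fderiv i (fexp v) = v 0 i *: fexp v.
Proof.
apply/fpsP => d /=; rewrite mderivZ.
have -> : (linform v ^+ d.+1)^`M(i) = (d.+1%:R * v 0 i) *: linform v ^+ d.
  have /fpsP/(_ 0%N)/= L := fderiv_fvec i v.
  elim: d => [|d IH]; first by rewrite expr1 L mul1r expr0.
  rewrite exprS mderivM L IH -scalerAl mul1r -scalerAr -exprS -scalerDl.
  by congr (_ *: _); rewrite -[d.+2%:R]natr1; ring.
rewrite !scalerA factS natrM; congr (_ *: _).
have : d`!%:R != 0 :> C by rewrite pnatr_eq0 -lt0n fact_gt0.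
have : d.+1%:R != 0 :> C by rewrite pnatr_eq0.
by move: d.+1%:R d`!%:R => a b a0 b0; field; rewrite a0 b0.
Qed.

Lemma in_hatS_fexp (z : 'rV[int]_N) : in_hatS (fexp (map_mx intr z) : S).
Proof. by exists [:: (1, z)]; rewrite big_seq1 scale1r. Qed.

Lemma in_hatS0 : in_hatS (0 : S).
Proof. by exists [::]; rewrite big_nil. Qed.

Lemma in_hatSD f g : in_hatS f -> in_hatS g -> in_hatS (f + g).
Proof. by move=> [s ->] [t ->]; exists (s ++ t); rewrite big_cat. Qed.

Lemma in_hatSZ c f : in_hatS f -> in_hatS (c *: f).
Proof.
move=> [s ->]; exists [seq (c * t.1, t.2) | t <- s].
by rewrite big_map scaler_sumr; apply: eq_bigr => t _; rewrite scalerA.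
Qed.

Lemma in_hatSN f : in_hatS f -> in_hatS (- f).
Proof. by rewrite -scaleN1r; apply: in_hatSZ. Qed.

Lemma in_hatSB f g : in_hatS f -> in_hatS g -> in_hatS (f - g).
Proof. by move=> hf /in_hatSN; apply: in_hatSD. Qed.

Lemma in_hatS_sum (I : Type) (r : seq I) (P : pred I) (F : I -> S) :
  (forall i, P i -> in_hatS (F i)) -> in_hatS (\sum_(i <- r | P i) F i).
Proof.
move=> h; elim/big_rec: _ => [|i f Pi]; first exact: in_hatS0.
by apply: in_hatSD; apply: h.
Qed.

Lemma in_hatSM f g : in_hatS f -> in_hatS g -> in_hatS (f * g).
Proof.
move=> [s ->] [t ->]; rewrite big_distrlr /=.
apply: in_hatS_sum => a _; apply: in_hatS_sum => b _.
rewrite -scalerAl -scalerAr -fexpD -map_mxD.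
by do 2!apply: in_hatSZ; apply: in_hatS_fexp.
Qed.

Lemma in_hatS_fderiv i f : in_hatS f -> in_hatS (fderiv i f).
Proof.
move=> [s ->]; rewrite linear_sum; apply: in_hatS_sum => t _.
rewrite linearZ /= fderiv_fexp.
by do 2!apply: in_hatSZ; apply: in_hatS_fexp.
Qed.

Lemma in_hatS_feps i : in_hatS (fexp (eps C i) : S).
Proof.
have -> : eps C i = map_mx intr (delta_mx 0 i) by rewrite map_delta_mx.
exact: in_hatS_fexp.
Qed.

(* With [w = eps i - eps j], e^v - e^(v - v_i w) is a multiple of x_i - x_j in
   \hat S(V), and the second exponentials cancel in the sum over the terms of f
   when w divides f in C[[V]]. *)
Lemma in_hatS_div i j f : i != j -> in_hatS f ->
  in_ideal (fvec (eps C i - eps C j)) f ->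
  exists2 g, in_hatS g & (fexp (eps C i) - fexp (eps C j)) * g = f.
Proof.
move=> ij hf; set w := eps C i - eps C j.
have wi : w 0 i = 1 by rewrite !mxE !eqxx (negPf ij) subr0.
rewrite (in_ideal_collapse _ wi) => f0.
pose D : S := fexp (eps C i) - fexp (eps C j).
pose zw : 'rV[int]_N := delta_mx 0 i - delta_mx 0 j.
have zwE : w = map_mx intr zw by rewrite map_mxB !map_delta_mx.
have Dnat n : exists2 g, in_hatS g & D * g = fexp (n%:R *: w) - 1.
  elim: n => [|n [g hg E]].
    by exists 0; [exact: in_hatS0 | rewrite mulr0 scale0r fexp0 subrr].
  (* e^((n+1)w) - 1 = (e^(nw) - 1) + e^(nw) (e^w - 1), and e^w - 1 = D e^(-eps_j). *)
  exists (g + fexp (n%:R *: w) * fexp (- eps C j)).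
    apply: in_hatSD hg _; rewrite -fexpD.
    have -> : n%:R *: w - eps C j = map_mx intr (n%:R *: zw - delta_mx 0 j).
      by rewrite map_mxB map_mxZ -zwE map_delta_mx /= rmorph_nat.
    exact: in_hatS_fexp.
  rewrite mulrDr E -natr1 scalerDl scale1r fexpD /w fexpD /D.
  have := fexpN (eps C j).
  move: (fexp (- eps C j)) (fexp (n%:R *: _)) (fexp (eps C i)) => a b c.
  move: (fexp (eps C j)) => d ad.
  by rewrite mulrBl [d * _]mulrCA [d * _]mulrC ad; ring.
have Dint (z : int) : exists2 g, in_hatS g & D * g = fexp (z%:~R *: w) - 1.
  case: z => n; first exact: Dnat.
  (* Here z = -(n+1), and e^(-u) - 1 = - e^(-u) (e^u - 1). *)
  have [g hg E] := Dnat n.+1; exists (- (fexp (- (n.+1%:R *: w)) * g)).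
    apply/in_hatSN/in_hatSM => //.
    have -> : - (n.+1%:R *: w) = map_mx intr (- (n.+1%:R *: zw)).
      by rewrite map_mxN map_mxZ -zwE rmorph_nat.
    exact: in_hatS_fexp.
  rewrite mulrN mulrCA E mulrBr fexpN mulr1 opprB NegzE mulrNz scaleNr.
  by [].
have Dfexp (z : 'rV[int]_N) : exists2 g, in_hatS g &
    D * g = fexp (map_mx intr z) - fexp (collapse i w (map_mx intr z)).
  have [g hg E] := Dint (z 0 i).
  (* e^z - e^(z - z_i w) = e^(z - z_i w) (e^(z_i w) - 1). *)
  exists (fexp (collapse i w (map_mx intr z)) * g).
    apply: in_hatSM hg; have -> : collapse i w (map_mx intr z) =
        map_mx intr (z - z 0 i *: zw); last exact: in_hatS_fexp.
    by rewrite /collapse map_mxB map_mxZ -zwE mxE.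
  rewrite mulrCA E mulrBr mulr1 -fexpD /collapse mxE subrK.
  by [].
have [s fE] := hf.
suff [g hg E] : exists2 g, in_hatS g & D * g = f - fps_act (collapse i w) f.
  by exists g => //; rewrite E f0 subr0.
rewrite {}fE {hf f f0}; elim: s => [|t s [g hg IH]].
  by exists 0; [exact: in_hatS0 | rewrite big_nil raddf0 mulr0 subrr].
have [h hh E] := Dfexp t.2; exists (t.1 *: h + g).
  by apply: in_hatSD hg; apply: in_hatSZ.
rewrite big_cons rmorphD /= linearZ /= fps_act_fexp mulrDr IH -scalerAr E.
by rewrite scalerBr opprD addrACA.
Qed.

End Exponentials.

(** * The bilinear form, its isometries and the derivations [dV] *)

Section Forms.
Context (C : numFieldType) (n m : nat) (k : C).
Local Notation V := 'rV[C]_(n + m).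
Local Notation S := (fps C (n + m)).
Implicit Types (u v w alpha : V) (i j l : 'I_(n + m)) (f : S).

Lemma bformC u v : bform k u v = bform k v u.
Proof. by apply: eq_bigr => i _; rewrite [u 0 i * _]mulrC. Qed.

Lemma bform_is_linear u : linear (bform k u : V -> C^o).
Proof.
move=> c v w; rewrite /bform scaler_sumr -big_split; apply: eq_bigr => i _.
by rewrite /GRing.scale /= !mxE; ring.
Qed.
HB.instance Definition _ u :=
  GRing.isLinear.Build C V C^o *:%R (bform k u : V -> C^o) (bform_is_linear u).

Lemma bformDl u v w : bform k (u + v) w = bform k u w + bform k v w.
Proof. by rewrite ![bform k _ w]bformC linearD. Qed.

Lemma bformZl c u w : bform k (c *: u) w = c * bform k u w.
Proof. by rewrite ![bform k _ w]bformC linearZ. Qed.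

Lemma bformDr u v w : bform k w (u + v) = bform k w u + bform k w v.
Proof. by rewrite linearD. Qed.

Lemma bformZr c u w : bform k w (c *: u) = c * bform k w u.
Proof. by rewrite linearZ. Qed.

Lemma bformNr u w : bform k w (- u) = - bform k w u.
Proof. by rewrite linearN. Qed.

Lemma bformNl u w : bform k (- u) w = - bform k u w.
Proof. by rewrite ![bform k _ w]bformC linearN. Qed.

Lemma bform_epsr u i : bform k u (eps C i) = k ^+ parity i * u 0 i.
Proof.
rewrite /bform (bigD1 i) //= big1 => [|j ji]; rewrite !mxE ?eqxx.
  by rewrite addr0 mulr1.
by rewrite (negPf ji) andbF !mulr0.
Qed.

Lemma bform_coord u v : bform k u v = \sum_i bform k u (eps C i) * v 0 i.
Proof. by apply: eq_bigr => i _; rewrite bform_epsr mulrA. Qed.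

Lemma reflection_is_linear alpha : linear (reflection k alpha).
Proof.
move=> c u v; rewrite /reflection bformDl bformZl.
rewrite scalerBr scalerA addrACA -opprD -scalerDl; congr (_ - _ *: _).
by rewrite mulrDr mulrDl; congr (_ + _); rewrite mulrCA !mulrA.
Qed.
HB.instance Definition _ alpha :=
  GRing.isLinear.Build C V V *:%R (reflection k alpha)
    (reflection_is_linear alpha).

Lemma reflection_isometry alpha u v : bform k alpha alpha != 0 ->
  bform k (reflection k alpha u) (reflection k alpha v) = bform k u v.
Proof.
move=> a0; rewrite /reflection !bformDl !bformDr !bformNl !bformNr.
rewrite !bformZl !bformZr [bform k alpha v]bformC.
by field.
Qed.

Lemma reflection_id alpha v :
  bform k v alpha = 0 -> reflection k alpha v = v.
Proof. by rewrite /reflection => ->; rewrite mulr0 mul0r scale0r subr0. Qed.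

Lemma reflection_self alpha :
  bform k alpha alpha != 0 -> reflection k alpha alpha = - alpha.
Proof.
move=> a0; rewrite /reflection mulfK // scaler_nat mulr2n opprD addrA subrr.
by rewrite add0r.
Qed.

Lemma reflectionN alpha : reflection k (- alpha) =1 reflection k alpha.
Proof.
move=> v; rewrite /reflection bformNl !bformNr opprK mulrN mulNr scaleNr.
by rewrite scalerN opprK.
Qed.

Lemma permV_is_linear (sigma : 'S_n) (tau : 'S_m) :
  linear (permV sigma tau : V -> V).
Proof. by move=> c u v; rewrite /permV mulmxDl scalemxAl. Qed.
HB.instance Definition _ sigma tau :=
  GRing.isLinear.Build C V V *:%R (permV sigma tau : V -> V)
    (permV_is_linear sigma tau).

Definition perm_index (sigma : 'S_n) (tau : 'S_m) i : 'I_(n + m) :=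
  match split i with
  | inl a => lshift m (sigma a)
  | inr b => rshift n (tau b)
  end.

Lemma permV_eps sigma tau i :
  permV sigma tau (eps C i) = eps C (perm_index sigma tau i).
Proof.
rewrite /perm_index; case: (split_ordP i) => a ->.
  exact: permV_lshift.
exact: permV_rshift.
Qed.

Lemma perm_index_inj sigma tau : injective (perm_index sigma tau).
Proof.
move=> i j; rewrite /perm_index.
case: (split_ordP i) => a ->; case: (split_ordP j) => b ->.
- by move/lshift_inj/perm_inj ->.
- by move/eqP; rewrite eq_lrshift.
- by move/eqP; rewrite eq_rlshift.
- by move/rshift_inj/perm_inj ->.
Qed.

Lemma parity_perm_index sigma tau i :
  parity (perm_index sigma tau i) = parity i.
Proof.
rewrite /perm_index; case: (split_ordP i) => a ->; rewrite /parity /=.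
  by rewrite ![(n <= _)%N]leqNgt !ltn_ord.
by rewrite !leq_addr.
Qed.

(** Indices are permuted within each parity, so the weights k^p(i) of the form are preserved. *)
Lemma permV_isometry sigma tau u v :
  bform k (permV sigma tau u) (permV sigma tau v) = bform k u v.
Proof.
have E i w : (permV sigma tau w) 0 (perm_index sigma tau i) = w 0 i.
  rewrite {1}[w]row_sum_delta linear_sum summxE (bigD1 i) //= big1 => [|j ji].
    by rewrite linearZ /= permV_eps !mxE !eqxx mulr1 addr0.
  rewrite linearZ /= permV_eps !mxE (inj_eq (@perm_index_inj _ _)).
  by rewrite [i == j]eq_sym (negPf ji) andbF mulr0.
rewrite /bform (reindex_inj (@perm_index_inj sigma tau)).
by apply: eq_bigr => i _; rewrite parity_perm_index !E.
Qed.

Lemma dV_is_linear v : linear (dV k v).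
Proof.
move=> c f1 f2; rewrite /dV scaler_sumr -big_split; apply: eq_bigr => i _ /=.
by rewrite linearP scalerDr !scalerA mulrC.
Qed.
HB.instance Definition _ v :=
  GRing.isLinear.Build C S S *:%R (dV k v) (dV_is_linear v).

Lemma dVDl u v f : dV k (u + v) f = dV k u f + dV k v f.
Proof.
by rewrite /dV -big_split; apply: eq_bigr => i _; rewrite bformDl scalerDl.
Qed.

Lemma dVZl c v f : dV k (c *: v) f = c *: dV k v f.
Proof.
by rewrite /dV scaler_sumr; apply: eq_bigr => i _; rewrite bformZl scalerA.
Qed.

Lemma dVNl v f : dV k (- v) f = - dV k v f.
Proof. by rewrite -scaleN1r dVZl scaleN1r. Qed.

Lemma dV_fexp v u : dV k v (fexp u) = bform k v u *: fexp u.
Proof.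
rewrite /dV bform_coord scaler_suml; apply: eq_bigr => i _.
by rewrite fderiv_fexp scalerA.
Qed.

Lemma in_hatS_dV v f : in_hatS f -> in_hatS (dV k v f).
Proof.
by move=> hf; apply: in_hatS_sum => i _; apply/in_hatSZ/in_hatS_fderiv.
Qed.

(** The chain rule produces the pairings of [g v] with the [g (eps j)], which the isometry turns
    into those of [v] with the [eps j]. *)
Lemma dV_act (g : {linear V -> V}) v f :
  (forall u w, bform k (g u) (g w) = bform k u w) ->
  dV k (g v) (fps_act g f) = fps_act g (dV k v f).
Proof.
move=> gP; rewrite /dV linear_sum /=.
under eq_bigr do rewrite fderiv_act scaler_sumr.
rewrite exchange_big; apply: eq_bigr => j _ /=.
under eq_bigr do rewrite scalerA.
by rewrite -scaler_suml -bform_coord gP linearZ.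
Qed.

Lemma in_ideal_dV v (a : S) f :
  dV k v a = 0 -> in_ideal a f -> in_ideal a (dV k v f).
Proof. by move=> a0 [h ->]; exists (dV k v h); rewrite dVM a0 mulr0 addr0. Qed.

End Forms.

(** * Quasi-invariance modulo the square of an odd root *)

Section OddRoot.
Context (C : numFieldType) (n m : nat) (k : C).
Local Notation V := 'rV[C]_(n + m).
Local Notation S := (fps C (n + m)).
Context (i j : 'I_(n + m)) (pi : parity i = 0%N) (pj : parity j = 1%N).
Context (k1 : 1 + k != 0).
Implicit Types (u v w : V) (l r : 'I_(n + m)) (f g h : S).

Local Notation e l := (eps C l).
Local Notation x l := (fexp (eps C l) : S).
Local Notation alpha := (e i - e j).
Local Notation a := (fvec (e i - e j) : S).
Local Notation w := (k *: e i + e j).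
Local Notation s := (fps_act (reflection k (e i - e j))).

(* As [c%:A] is itself [c *: 1], rewriting [c *: f] into [c%:A * f] loops. *)
Definition cst (c : C) : S := c%:A.

Lemma scaleE c f : c *: f = cst c * f.
Proof. by rewrite /cst -scalerAl mul1r. Qed.

Lemma cst1D c : cst (1 + c) = 1 + cst c.
Proof. by rewrite /cst scalerDl scale1r. Qed.

Local Notation K := (cst k).

Lemma odd_neq : i != j.
Proof. by apply/eqP => ij; move: pi; rewrite ij pj. Qed.

Lemma odd_coord : alpha 0 i = 1.
Proof. by rewrite !mxE !eqxx (negPf odd_neq) subr0. Qed.

Lemma bform_odd_epsi : bform k alpha (e i) = 1.
Proof. by rewrite bform_epsr pi expr0 mul1r odd_coord. Qed.

Lemma bform_odd_epsj : bform k alpha (e j) = - k.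
Proof.
rewrite bform_epsr pj expr1 !mxE !eqxx /= eq_sym (negPf odd_neq) sub0r.
by rewrite mulrN1.
Qed.

Lemma bform_odd_eps l : l != i -> l != j -> bform k alpha (e l) = 0.
Proof.
by move=> li lj; rewrite bform_epsr !mxE (negPf li) (negPf lj) subrr mulr0.
Qed.

Lemma bform_odd_self : bform k alpha alpha = 1 + k.
Proof. by rewrite linearB /= bform_odd_epsi bform_odd_epsj opprK. Qed.

Lemma bform_odd_orth : bform k alpha w = 0.
Proof.
by rewrite bformDr bformZr bform_odd_epsi bform_odd_epsj mulr1 subrr.
Qed.

Lemma odd_reflection_self : reflection k alpha alpha = - alpha.
Proof. by rewrite reflection_self // bform_odd_self. Qed.

Lemma odd_reflection_id u : bform k alpha u = 0 -> reflection k alpha u = u.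
Proof. by rewrite bformC => /reflection_id. Qed.

Lemma odd_act_root : s a = - a.
Proof. by rewrite fps_act_fvec /= odd_reflection_self fvecN. Qed.

(** The reflection moves every basis vector by a multiple of alpha. *)
Lemma odd_act_sub f : in_ideal a (s f - f).
Proof.
apply: (@fps_act_sub _ _ _ _
  (fun l => - (2 * bform k (e l) alpha / bform k alpha alpha))) => l.
by rewrite /reflection scaleNr.
Qed.

Lemma odd_dV_orth u : bform k alpha u = 0 -> dV k u a = 0.
Proof. by move=> au; rewrite dV_fvec bformC au scale0r. Qed.

Lemma odd_dV_root : dV k alpha a = cst (1 + k).
Proof. by rewrite dV_fvec bform_odd_self. Qed.

Lemma odd_isometry u v :
  bform k (reflection k alpha u) (reflection k alpha v) = bform k u v.
Proof. by apply: reflection_isometry; rewrite bform_odd_self. Qed.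

Lemma odd_dV_act u f : bform k alpha u = 0 -> s (dV k u f) = dV k u (s f).
Proof.
move=> au; rewrite -{2}(odd_reflection_id au).
by rewrite (@dV_act _ _ _ _ (reflection k alpha)) //; apply: odd_isometry.
Qed.

Lemma odd_dV_root_act f : s (dV k alpha f) = - dV k alpha (s f).
Proof.
have := @dV_act _ _ _ _ (reflection k alpha) alpha f odd_isometry.
by rewrite /= odd_reflection_self dVNl.
Qed.

(** The condition on a quasi-homomorphism at vectors orthogonal to alpha, which the reflection
    fixes. *)
Definition quasi_invariant f := in_ideal (a ^+ 2) (s f - f).

Lemma quasi_invariant_fix f : s f = f -> quasi_invariant f.
Proof. by rewrite /quasi_invariant => ->; rewrite subrr; apply: in_ideal0. Qed.

Lemma quasi_invariantD f g :
  quasi_invariant f -> quasi_invariant g -> quasi_invariant (f + g).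
Proof.
by rewrite /quasi_invariant raddfD opprD addrACA; apply: in_idealD.
Qed.

Lemma quasi_invariantZ c f : quasi_invariant f -> quasi_invariant (c *: f).
Proof.
by rewrite /quasi_invariant linearZ /= -scalerBr; apply: in_idealZ.
Qed.

Lemma quasi_invariantN f : quasi_invariant f -> quasi_invariant (- f).
Proof. by rewrite -scaleN1r; apply: quasi_invariantZ. Qed.

Lemma quasi_invariantB f g :
  quasi_invariant f -> quasi_invariant g -> quasi_invariant (f - g).
Proof. by move=> hf /quasi_invariantN; apply: quasi_invariantD. Qed.

Lemma quasi_invariantM f g :
  quasi_invariant f -> quasi_invariant g -> quasi_invariant (f * g).
Proof.
rewrite /quasi_invariant rmorphM /= => hf hg.
have -> : s f * s g - f * g = (s f - f) * s g + f * (s g - g) by ring.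
by apply: in_idealD; [apply: in_idealMr | apply: in_idealM].
Qed.

Lemma quasi_invariant_sum (I : Type) (t : seq I) (P : pred I) (F : I -> S) :
  (forall q, P q -> quasi_invariant (F q)) ->
  quasi_invariant (\sum_(q <- t | P q) F q).
Proof.
move=> h; elim/big_rec: _ => [|q f Pq].
  by apply: quasi_invariant_fix; rewrite raddf0.
by apply: quasi_invariantD; apply: h.
Qed.

Lemma quasi_invariant_scale c f :
  c != 0 -> quasi_invariant (c *: f) -> quasi_invariant f.
Proof.
move=> c0; rewrite /quasi_invariant linearZ /= -scalerBr.
exact: in_ideal_scale.
Qed.

(** A derivation along a vector orthogonal to alpha commutes with the reflection and kills a^2. *)
Lemma quasi_invariant_dV u f :
  bform k alpha u = 0 -> quasi_invariant f -> quasi_invariant (dV k u f).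
Proof.
move=> au; rewrite /quasi_invariant odd_dV_act // -linearB /=.
by apply: in_ideal_dV; rewrite expr2 dVM odd_dV_orth // mul0r mulr0 addr0.
Qed.

(** Modulo a^2, [f * (s g - g)] vanishes, and [f] can be cancelled since (a^2) is primary. *)
Lemma quasi_invariant_div f g :
  quasi_invariant f -> quasi_invariant (f * g) -> ~ in_ideal a f ->
  quasi_invariant g.
Proof.
rewrite /quasi_invariant rmorphM /= => hf hfg.
apply: (in_ideal_sqr_prime odd_coord).
have -> : f * (s g - g) = (s f * s g - f * g) - (s f - f) * s g by ring.
by apply: in_idealB => //; apply: in_idealMr.
Qed.

(** As s a = -a, the reflection preserves the ideal (a^2). *)
Lemma quasi_invariant_cong f g :
  in_ideal (a ^+ 2) (f - g) -> quasi_invariant f -> quasi_invariant g.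
Proof.
rewrite /quasi_invariant => fg hf.
have sfg : in_ideal (a ^+ 2) (s (f - g)).
  have [h ->] := fg; exists (s h).
  by rewrite rmorphM rmorphXn /= odd_act_root sqrrN.
have -> : s g - g = (s f - f) - s (f - g) + (f - g) by rewrite raddfB /=; ring.
by apply: in_idealD fg; apply: in_idealB.
Qed.

(* The reflection anticommutes with the derivation along alpha. *)
Lemma quasi_invariantP f : quasi_invariant f <-> in_ideal a (dV k alpha f).
Proof.
split=> [[h hh]|hf]; last first.
  have [h hh] := odd_act_sub f; rewrite /quasi_invariant hh expr2.
  suff [q ->] : in_ideal a h by exists q; rewrite mulrA.
  apply: (in_ideal_scale k1).
  (* Differentiate [s f - f = h * a] along alpha and solve for [h], using that alpha has derivative
     1 + k along itself. *)
  have -> : (1 + k) *: h = - (s (dV k alpha f) - dV k alpha f)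
      - 2 *: dV k alpha f - dV k alpha h * a.
    have e : dV k alpha h * a + h * cst (1 + k) =
        - s (dV k alpha f) - dV k alpha f.
      by rewrite -odd_dV_root -dVM -hh linearB /= odd_dV_root_act opprK.
    rewrite [(1 + k) *: h]scaleE -[LHS](addKr (dV k alpha h * a)).
    by rewrite [cst _ * h]mulrC e scaler_nat; ring.
  apply: in_idealB; last by exists (dV k alpha h).
  apply: in_idealB; last exact: in_idealZ.
  by apply: in_idealN; apply: odd_act_sub.
have two0 : - 2 != 0 :> C by rewrite oppr_eq0 pnatr_eq0.
apply: (in_ideal_scale two0).
have -> : - 2 *: dV k alpha f =
    (s (dV k alpha f) - dV k alpha f) + dV k alpha (s f - f).
  by rewrite odd_dV_root_act linearB /= scaleNr scaler_nat; ring.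
apply: in_idealD; first exact: odd_act_sub.
exists (dV k alpha h * a + h * (2 * cst (1 + k))).
by rewrite hh expr2 !dVM odd_dV_root; ring.
Qed.

Lemma odd_exp_sub : in_ideal a (x i - x j).
Proof.
rewrite (in_ideal_collapse _ odd_coord) raddfB /= !fps_act_fexp.
apply/eqP; rewrite subr_eq0; apply/eqP; congr fexp; apply/rowP => t.
by rewrite !mxE !eqxx /= [i == j](negPf odd_neq) mul1r mul0r subr0 subKr.
Qed.

(** The derivative along alpha is k (x_i - x_j), which lies in (a). *)
Lemma quasi_invariant_exp_orth : quasi_invariant (k *: x i + x j).
Proof.
apply/quasi_invariantP; rewrite linearD linearZ /= !dV_fexp.
rewrite bform_odd_epsi bform_odd_epsj scale1r scaleNr -scalerBr.
exact/in_idealZ/odd_exp_sub.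
Qed.

(** Setting eps_i := eps_j leaves coordinate [l] of the exponents alone, so the two exponentials
    stay distinct; [r] may be [i] or [j]. *)
Lemma odd_exp_notin l r :
  l != i -> l != j -> l != r -> ~ in_ideal a (x l - x r).
Proof.
move=> li lj lr; rewrite (in_ideal_collapse _ odd_coord) raddfB /=.
rewrite !fps_act_fexp /= => /eqP; rewrite subr_eq0 => /eqP/fexp_inj.
move=> /rowP/(_ l)/eqP; rewrite !mxE !eqxx (negPf li) (negPf lj) (negPf lr).
by rewrite /= !subr0 !mulr0 !subr0 oner_eq0.
Qed.


(* With X = (1 + k) x_l - (k x_i + x_j) and F defined likewise from the f's,
   X (k g_1 + g_2) = (1 + k) F modulo a^2, and X, F are quasi-invariant. *)
Lemma quasi_invariant_quotients (xi xj xl fi fj fl g1 g2 : S) :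
  in_ideal a (xi - xj) -> in_ideal a (fi - fj) ->
  quasi_invariant (k *: xi + xj) -> quasi_invariant (k *: fi + fj) ->
  quasi_invariant xl -> quasi_invariant fl -> ~ in_ideal a (xl - xi) ->
  (xl - xi) * g1 = fl - fi -> (xl - xj) * g2 = fl - fj ->
  quasi_invariant (k *: g1 + g2).
Proof.
move=> [q hq] [g hg] hX hF hl hfl nl e1 e2.
pose X := (1 + k) *: xl - (k *: xi + xj).
pose F := (1 + k) *: fl - (k *: fi + fj).
have iX : quasi_invariant X.
  by apply: quasi_invariantB hX; apply: quasi_invariantZ.
have iF : quasi_invariant F.
  by apply: quasi_invariantB hF; apply: quasi_invariantZ.
pose E := k *: g1 + g2; rewrite -/E.
have nA : ~ in_ideal a ((1 + k) *: (xl - xi)) by move/(in_ideal_scale k1).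
have XE : X = (1 + k) *: (xl - xi) + q * a.
  by rewrite -hq /X !scaleE cst1D; ring.
have d1 : (X - q * a) * g1 = F - g * a.
  rewrite XE addrK -scalerAl e1 -hg /F !scaleE cst1D; ring.
have d2 : (X + K * q * a) * g2 = F + K * g * a.
  have -> : X + K * q * a = (1 + k) *: (xl - xj).
    by rewrite -mulrA -hq /X !scaleE cst1D; ring.
  by rewrite -scalerAl e2 -mulrA -hg /F !scaleE cst1D; ring.
(* Modulo a^2, the product of the two denominators X - q a and X + K q a is X times this factor,
   which will be cancelled. *)
have nB : ~ in_ideal a (X + (K - 1) * q * a).
  have -> : X + (K - 1) * q * a = (1 + k) *: (xl - xi) + K * q * a.
    by rewrite XE; ring.
  move=> h; apply: nA; rewrite -[X in in_ideal _ X](addrK (K * q * a)).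
  by apply: in_idealB h _; exists (K * q).
have nX : ~ in_ideal a X.
  move=> h; apply: nB; apply: in_idealD h _; by exists ((K - 1) * q).
have : in_ideal (a ^+ 2) (X * E - (1 + k) *: F).
  apply: (in_ideal_sqr_prime odd_coord _ nB).
  (* Adding K (X + K q a) times [d1] to (X - q a) times [d2] makes the terms of first order in [a]
     combine into the factor of [nB]; the witness collects the a^2 terms. *)
  exists (K * q ^+ 2 * E - K * (1 + K) * g * q).
  apply/eqP; rewrite -subr_eq0; apply/eqP.
  transitivity (K * (X + K * q * a) * ((X - q * a) * g1 - (F - g * a)) +
                (X - q * a) * ((X + K * q * a) * g2 - (F + K * g * a))).
    by rewrite /E !scaleE cst1D; ring.
  by rewrite d1 d2 !subrr !mulr0 addr0.
move=> /in_idealN; rewrite opprB => h.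
apply: quasi_invariant_div iX _ nX; apply: quasi_invariant_cong h _.
exact: quasi_invariantZ.
Qed.

(* With u = e^(alpha/2) and v = e^(-alpha/2), exchanged by the reflection, and
   H = e^((eps_i + eps_j)/2) g, the expression is (u - v) D H - (D (u - v)) H,
   D being the derivation along alpha. *)
Lemma quasi_invariant_residue g f : f = (x i - x j) * g ->
  quasi_invariant (dV k alpha f - (1 + k) *: ((x i + x j) * g)).
Proof.
pose b : V := 2^-1 *: (e i + e j); pose c : V := 2^-1 *: alpha.
have two0 : 2 != 0 :> C by rewrite pnatr_eq0.
have -> : x i = fexp c * fexp b.
  by rewrite -fexpD; congr fexp; apply/rowP => t; rewrite !mxE; field.
have -> : x j = fexp (- c) * fexp b.
  by rewrite -fexpD; congr fexp; apply/rowP => t; rewrite !mxE; field.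
have su : s (fexp c) = fexp (- c).
  by rewrite fps_act_fexp linearZ /= odd_reflection_self scalerN.
have sv : s (fexp (- c)) = fexp c.
  by rewrite fps_act_fexp linearN linearZ /= odd_reflection_self scalerN opprK.
pose t := (1 + k) / 2.
have du : dV k alpha (fexp c) = t *: fexp c.
  by rewrite dV_fexp bformZr bform_odd_self mulrC.
have dv : dV k alpha (fexp (- c)) = - (t *: fexp (- c)).
  by rewrite dV_fexp bformNr bformZr bform_odd_self mulrC scaleNr.
move: (fexp c) (fexp (- c)) su sv du dv => u v su sv du dv.
rewrite -mulrBl -mulrDl -!mulrA; move: (fexp b * g) => H ->.
have [q hq] : in_ideal a (u - v) by rewrite -sv; apply: odd_act_sub.
have [h hh] := odd_act_sub H.
have dq : t *: (u + v) = dV k alpha q * a + q * cst (1 + k).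
  by rewrite -odd_dV_root -dVM -hq linearB /= du dv opprK scalerDr.
have kt : 1 + k = t + t by rewrite /t; field.
have -> : dV k alpha ((u - v) * H) - (1 + k) *: ((u + v) * H) =
    (u - v) * dV k alpha H - t *: (u + v) * H.
  by rewrite dVM linearB /= du dv kt scalerDl opprK !scaleE; ring.
(* Applying s to the expression amounts to replacing H by s H = H + h a. The change is q a D(h a) -
   D(q a) h a, a Wronskian in which the terms of first order in [a] cancel. *)
exists (q * dV k alpha h - dV k alpha q * h).
rewrite linearB /= -!scalerAl linearZ /= !rmorphM rmorphB rmorphD /= su sv.
rewrite odd_dV_root_act !scalerAl [v + u]addrC.
have -> : s H = H + h * a by rewrite -hh addrCA subrr addr0.
rewrite linearD /= dVM odd_dV_root dq -[v - u]opprB hq.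
by ring.
Qed.

(** The two brackets are the parts of psi(eps_i) and psi(eps_j) that involve only the pair i, j.
    They are rewritten with derivations along alpha and [w]: the first sends k f_i + f_j into (a),
    the second preserves (a), and the remaining terms are multiples of x_i - x_j. *)
Lemma odd_residue_sub fi fj g :
  fi - fj = (x i - x j) * g -> quasi_invariant (k *: fi + fj) ->
  in_ideal a ((dV k (e i) fi - x i * g) - (dV k (e j) fj - k *: (x j * g))).
Proof.
move=> hg hF.
have xij := odd_exp_sub.
have da : in_ideal a (fi - fj) by rewrite hg; apply: in_idealMr.
apply: (in_ideal_scale k1).
have -> : (1 + k) *: ((dV k (e i) fi - x i * g) -
                      (dV k (e j) fj - k *: (x j * g)))
  = dV k alpha (k *: fi + fj) + dV k w (fi - fj)
    + ((1 - K) * ((x i - x j) * dV k alpha g) - (2 * K * g) * (x i - x j)).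
  (* Leibniz for (x_i - x_j) g, where x_i - x_j has derivative x_i + k x_j along alpha. *)
  have E : (x i - x j) * dV k alpha g =
      dV k alpha (fi - fj) - (x i + k *: x j) * g.
    rewrite hg dVM linearB /= !dV_fexp bform_odd_epsi bform_odd_epsj scale1r.
    by rewrite scaleNr opprK; ring.
  rewrite E !dVDl !dVNl !dVZl !linearB !linearD !linearZ /= !scaleE cst1D.
  by ring.
apply: in_idealD; [apply: in_idealD|].
- exact/quasi_invariantP.
- by apply: in_ideal_dV da; apply: odd_dV_orth bform_odd_orth.
- apply: in_idealB; apply: in_idealM => //; exact: in_idealMr.
Qed.

(** The mixed terms D_i f_j and D_j f_i cancel between the derivation along [w] of k f_i + f_j and k
    times the expression of [quasi_invariant_residue]. *)
Lemma odd_residue_invariant fi fj g :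
  fi - fj = (x i - x j) * g -> quasi_invariant (k *: fi + fj) ->
  quasi_invariant
    (k *: (dV k (e i) fi - x i * g) + (dV k (e j) fj - k *: (x j * g))).
Proof.
move=> hg hF; apply: (quasi_invariant_scale k1).
have -> : (1 + k) *: (k *: (dV k (e i) fi - x i * g) +
                      (dV k (e j) fj - k *: (x j * g)))
  = dV k w (k *: fi + fj)
    + k *: (dV k alpha (fi - fj) - (1 + k) *: ((x i + x j) * g)).
  rewrite !dVDl !dVNl !dVZl !linearB !linearD !linearZ /= !scaleE cst1D.
  by ring.
apply: quasi_invariantD; first exact: quasi_invariant_dV bform_odd_orth hF.
exact/quasi_invariantZ/quasi_invariant_residue.
Qed.

End OddRoot.

(** * The condition at an odd root, tested on a spanning set *)

Section Criterion.
Context (C : numFieldType) (n m : nat) (k : C).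
Local Notation V := 'rV[C]_(n + m).
Local Notation S := (fps C (n + m)).
Context (i j : 'I_(n + m)) (pi : parity i = 0%N) (pj : parity j = 1%N).
Context (k1 : 1 + k != 0) (psi : {linear V -> S}).

Local Notation alpha := (eps C i - eps C j).
Local Notation s := (reflection k alpha).

Lemma odd_condition_orth v : bform k alpha v = 0 ->
  in_ideal (fvec alpha ^+ 2) (fps_act s (psi v) - psi (s v)) <->
  quasi_invariant k i j (psi v).
Proof. by move=> av; rewrite odd_reflection_id. Qed.

(** As s alpha = -alpha, the condition concerns s psi(alpha) + psi(alpha). If psi(alpha) = h a, this
    sum is -(s h - h) a, and s h - h is again in (a). *)
Lemma odd_condition_root :
  in_ideal (fvec alpha ^+ 2) (fps_act s (psi alpha) - psi (s alpha)) <->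
  in_ideal (fvec alpha) (psi alpha).
Proof.
have two0 : 2 != 0 :> C by rewrite pnatr_eq0.
rewrite odd_reflection_self // linearN /= opprK; split=> [h|[h hh]].
  apply: (in_ideal_scale two0).
  have -> : 2 *: psi alpha =
      (fps_act s (psi alpha) + psi alpha) - (fps_act s (psi alpha) - psi alpha).
    by rewrite scaler_nat; ring.
  by apply: in_idealB; [apply: in_ideal_sqr | apply: odd_act_sub].
have [q hq] := odd_act_sub k i j h; exists (- q).
rewrite hh rmorphM /= odd_act_root // expr2 mulrA mulNr -hq; ring.
Qed.

Lemma odd_conditionP :
  (forall v,
     in_ideal (fvec alpha ^+ 2) (fps_act s (psi v) - psi (s v))) <->
  [/\ in_ideal (fvec alpha) (psi (eps C i) - psi (eps C j)),
      quasi_invariant k i j (k *: psi (eps C i) + psi (eps C j)) &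
      forall l, l != i -> l != j -> quasi_invariant k i j (psi (eps C l))].
Proof.
have psiw : k *: psi (eps C i) + psi (eps C j) = psi (k *: eps C i + eps C j).
  by rewrite linearD linearZ.
rewrite psiw -linearB; split=> [h|[hr hw hl] v].
  split; first by rewrite -odd_condition_root.
    by rewrite -odd_condition_orth // bform_odd_orth.
  by move=> l li lj; rewrite -odd_condition_orth // bform_odd_eps.
pose P v := in_ideal (fvec alpha ^+ 2) (fps_act s (psi v) - psi (s v)).
have PD u1 u2 : P u1 -> P u2 -> P (u1 + u2).
  rewrite /P [psi (u1 + u2)]linearD [s (u1 + u2)]linearD.
  rewrite [psi (s u1 + s u2)]linearD rmorphD /= opprD addrACA.
  exact: in_idealD.
have PZ c u : P u -> P (c *: u).
  rewrite /P [psi (c *: u)]linearZ [s (c *: u)]linearZ [psi (c *: s u)]linearZ.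
  by rewrite linearZ /= -scalerBr; apply: in_idealZ.
have Pr : P alpha by rewrite /P odd_condition_root.
have Pw : P (k *: eps C i + eps C j).
  by rewrite /P odd_condition_orth // bform_odd_orth.
(* w + alpha = (1 + k) eps_i. *)
have Pi : P (eps C i).
  have -> : eps C i = (1 + k)^-1 *: ((k *: eps C i + eps C j) + alpha).
    by apply/rowP => t; rewrite !mxE; field.
  exact/PZ/PD.
have Pj : P (eps C j).
  have -> : eps C j = eps C i + (-1) *: alpha.
    by apply/rowP => t; rewrite !mxE; ring.
  by apply: PD Pi _; apply: PZ.
rewrite [v]row_sum_delta; elim/big_rec: _ => [|l u _ Pu].
  rewrite /P [psi 0]linear0 [s 0]linear0 [psi 0]linear0 rmorph0 subrr.
  exact: in_ideal0.
apply: PD Pu; apply: PZ.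
have [->|li] := eqVneq l i; first exact: Pi.
have [->|lj] := eqVneq l j; first exact: Pj.
by rewrite /P odd_condition_orth ?bform_odd_eps //; apply: hl.
Qed.

End Criterion.

(** * The image under the Moser matrix at an odd root *)

Section Moser.
Context (C : numFieldType) (n m : nat) (k : C).
Local Notation V := 'rV[C]_(n + m).
Local Notation S := (fps C (n + m)).
Context (k1 : 1 + k != 0) (phi : {linear V -> S}).
Implicit Types (i j l r : 'I_(n + m)).

Local Notation x l := (fexp (eps C l) : S).
Local Notation f l := (phi (eps C l)).

Lemma exp_sub_neq0 i j : i != j -> x i - x j != 0.
Proof.
apply: contraNneq => /eqP; rewrite subr_eq0 => /eqP/fexp_inj/rowP/(_ i).
by rewrite !mxE !eqxx /=; case: eqP => // _ /eqP; rewrite oner_eq0.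
Qed.

Context (G : 'I_(n + m) -> 'I_(n + m) -> S).
Context (hG : forall i j, i != j -> (x i - x j) * G i j = f i - f j).

Lemma quotientC i j : i != j -> G i j = G j i.
Proof.
move=> ij; apply: (mulfI (exp_sub_neq0 ij)); rewrite hG // -[x i - x j]opprB mulNr.
by rewrite hG 1?eq_sym // opprB.
Qed.

(** Denominator-free form of psi(eps_i); [moser_sum] identifies it with the Moser sum. *)
Definition moser_fps i : S :=
  dV k (eps C i) (f i)
  - \sum_(r | r != i) k ^+ (1 - parity r) *: (x i * G i r).

Lemma moser_fps_split i j : i != j ->
  moser_fps i = (dV k (eps C i) (f i) - k ^+ (1 - parity j) *: (x i * G i j))
    - \sum_(r | (r != i) && (r != j)) k ^+ (1 - parity r) *: (x i * G i r).
Proof.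
by move=> ij; rewrite /moser_fps (bigD1 j) 1?eq_sym //= opprD addrA.
Qed.

Section Odd.
Context (i j : 'I_(n + m)) (pi : parity i = 0%N) (pj : parity j = 1%N).
Local Notation alpha := (eps C i - eps C j).
Local Notation qinv := (quasi_invariant k i j).
Context (hr : in_ideal (fvec alpha) (f i - f j)).
Context (hw : qinv (k *: f i + f j)).
Context (hl : forall l, l != i -> l != j -> qinv (f l)).

Let ij : i != j := odd_neq pi pj.

Lemma qinv_exp v : bform k alpha v = 0 -> qinv (fexp v).
Proof.
move=> av; apply: quasi_invariant_fix.
by rewrite fps_act_fexp /= odd_reflection_id.
Qed.

Lemma qinv_x l : l != i -> l != j -> qinv (x l).
Proof. by move=> li lj; apply: qinv_exp; rewrite bform_odd_eps. Qed.

Lemma qinv_quotient_pair l : l != i -> l != j ->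
  qinv (k *: G l i + G l j).
Proof.
move=> li lj; apply: (@quasi_invariant_quotients _ _ _ _ _ _ pi pj k1
  (x i) (x j) (x l) (f i) (f j) (f l)) => //.
- exact: odd_exp_sub.
- exact: quasi_invariant_exp_orth.
- exact: qinv_x.
- exact: hl.
- exact: odd_exp_notin.
- exact: hG.
- exact: hG.
Qed.

Lemma qinv_quotient l r : l != i -> l != j -> r != i -> r != j -> l != r ->
  qinv (G l r).
Proof.
move=> li lj ri rj lr.
apply: (@quasi_invariant_div _ _ _ _ _ _ pi pj (x l - x r)).
- by apply: quasi_invariantB; apply: qinv_x.
- by rewrite hG //; apply: quasi_invariantB; apply: hl.
- exact: odd_exp_notin.
Qed.

(** The terms r = i and r = j carry the weights k and 1, so together they give x_l (k G_li + G_lj),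
    the combination known to be quasi-invariant. *)
Lemma moser_qinv l : l != i -> l != j -> qinv (moser_fps l).
Proof.
move=> li lj; rewrite (moser_fps_split li) (bigD1 j) /=; last first.
  by rewrite ![j == _]eq_sym lj ij.
rewrite pi pj expr1 expr0 scale1r opprD addrA.
have -> : dV k (eps C l) (f l) - k *: (x l * G l i) - x l * G l j =
    dV k (eps C l) (f l) - x l * (k *: G l i + G l j).
  by rewrite !scaleE; ring.
apply: quasi_invariantB; first apply: quasi_invariantB.
- by apply: quasi_invariant_dV; rewrite ?bform_odd_eps //; apply: hl.
- by apply: quasi_invariantM; [apply: qinv_x | apply: qinv_quotient_pair].
apply: quasi_invariant_sum => r /andP[/andP[rl ri] rj].
apply/quasi_invariantZ/quasi_invariantM; first exact: qinv_x.
by apply: qinv_quotient; rewrite 1?[l == r]eq_sym.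
Qed.

(** For [l] equal to [i] or [j], this trades the coefficient x_l for x_r, which the reflection fixes
    when [r] is another index. *)
Lemma quotient_expand l r : l != r -> x l * G l r = f l - f r + x r * G r l.
Proof. by move=> lr; rewrite -hG // (quotientC lr); ring. Qed.

(** The pair i, j is settled by [odd_residue_sub]. For any other r, the contribution reduces to f_i
    - f_j and x_r (G_rj - G_ri). *)
Lemma moser_root : in_ideal (fvec alpha) (moser_fps i - moser_fps j).
Proof.
rewrite (moser_fps_split ij) (@moser_fps_split j i) 1?eq_sym //.
rewrite pi pj expr1 expr0 scale1r [G j i]quotientC 1?eq_sym // opprD addrACA.
apply: in_idealD.
  by apply: (odd_residue_sub pi pj k1) hw; rewrite hG.
rewrite opprK addrC (eq_bigl (fun r => (r != i) && (r != j))); last first.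
  by move=> r; rewrite andbC.
rewrite -sumrB; apply: in_ideal_sum => r /andP[ri rj].
rewrite -scalerBr; apply: in_idealZ.
rewrite (@quotient_expand i) 1?eq_sym // (@quotient_expand j) 1?eq_sym //.
have -> : f j - f r + x r * G r j - (f i - f r + x r * G r i) =
    x r * (G r j - G r i) - (f i - f j) by ring.
apply: in_idealB => //; apply: in_idealM.
(* Multiplied by x_r - x_j, the difference of quotients becomes (f_i - f_j) - (x_i - x_j) G_ri,
   which is in (a). *)
apply: (@in_ideal_prime _ _ _ alpha (x r - x j) _ (odd_coord C pi pj)).
  have -> : (x r - x j) * (G r j - G r i) =
      (x r - x j) * G r j - (x r - x i) * G r i - (x i - x j) * G r i by ring.
  rewrite !hG //; have -> : f r - f j - (f r - f i) = f i - f j by ring.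
  by apply: in_idealB => //; apply/in_idealMr/odd_exp_sub.
exact: odd_exp_notin.
Qed.

(** Each r other than i, j contributes a multiple of k x_i G_ir + x_j G_jr, which expands into k f_i
    + f_j, f_r and x_r (k G_ri + G_rj), all quasi-invariant. *)
Lemma moser_orth : qinv (k *: moser_fps i + moser_fps j).
Proof.
rewrite (moser_fps_split ij) (@moser_fps_split j i) 1?eq_sym //.
rewrite pi pj expr1 expr0 scale1r [G j i]quotientC 1?eq_sym //.
rewrite scalerBr addrACA; apply: quasi_invariantD.
  by apply: (odd_residue_invariant pi pj k1) hw; rewrite hG.
rewrite -opprD; apply: quasi_invariantN.
rewrite scaler_sumr.
rewrite [X in _ + X](eq_bigl (fun r => (r != i) && (r != j))); last first.
  by move=> r; rewrite andbC.
rewrite -big_split; apply: quasi_invariant_sum => r /andP[ri rj] /=.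
rewrite scalerA mulrC -scalerA -scalerDr; apply: quasi_invariantZ.
rewrite (@quotient_expand i) 1?eq_sym // (@quotient_expand j) 1?eq_sym //.
have -> : k *: (f i - f r + x r * G r i) + (f j - f r + x r * G r j) =
    (k *: f i + f j) - (1 + k) *: f r + x r * (k *: G r i + G r j).
  by rewrite !scaleE cst1D; ring.
apply: quasi_invariantD.
  by apply: quasi_invariantB hw _; apply/quasi_invariantZ/hl.
by apply: quasi_invariantM; [apply: qinv_x | apply: qinv_quotient_pair].
Qed.

End Odd.
End Moser.

(** * Embedding of C[[V]] in its fraction field *)

Section Fractions.
Context (C : fieldType) (N : nat).
Implicit Types (f g : fps C N).

Lemma tofpsZ c f : tofps (c *: f) = c *: tofps f.
Proof.
have -> : c *: tofps f = tofps c%:A * tofps f by [].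
by rewrite -rmorphM -scalerAl mul1r.
Qed.

Lemma tofps_is_scalable : scalable (@tofps C N).
Proof. by move=> c f; apply: tofpsZ. Qed.
HB.instance Definition _ :=
  GRing.isScalable.Build C (fps C N) (fpsfrac C N) *:%R (@tofps C N)
    tofps_is_scalable.

Lemma tofps_eq0 f : (tofps f == 0) = (f == 0).
Proof. exact: tofrac_eq0. Qed.

End Fractions.

(** * The Moser sum, its equivariance, and the even roots *)

Section MoserOperator.
Context (C : numFieldType) (n m : nat) (k : C).
Local Notation V := 'rV[C]_(n + m).
Local Notation S := (fps C (n + m)).
Context (phi : {linear V -> S}).
Implicit Types (i j l r : 'I_(n + m)).

Local Notation x l := (fexp (eps C l) : S).
Local Notation f l := (phi (eps C l)).

Context (G : 'I_(n + m) -> 'I_(n + m) -> S).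
Context (hG : forall i j, i != j -> (x i - x j) * G i j = f i - f j).

(** Each summand of the diagonal entry pairs with the off-diagonal entry of the same weight, giving
    x_i (f_i - f_r) / (x_i - x_r). *)
Lemma moser_sum i : \sum_j moser k i j (f j) = tofps (moser_fps k phi G i).
Proof.
rewrite (bigD1 i) //= {1}/moser eqxx rmorphB /= -addrA; congr (_ + _).
rewrite addrC -opprB -sumrB; congr (- _).
rewrite linear_sum; apply: eq_bigr => r ri /=.
rewrite /moser eq_sym (negPf ri) tofpsZ rmorphM /= -scalerBr -mulrBr.
have ir : i != r by rewrite eq_sym.
have D0 : xfrac C i - xfrac C r != 0 by rewrite -rmorphB tofps_eq0 exp_sub_neq0.
by rewrite -[tofps (f i) - _]rmorphB -hG // rmorphM rmorphB /= mulrA divfK.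
Qed.

(** A permutation carries the equation defining G_ir to the one for the permuted indices, so it
    permutes the quotients; it also preserves the weights. *)
Lemma moser_act (sigma : 'S_n) (tau : 'S_m) i :
  (forall v, phi (permV sigma tau v) = fps_act (permV sigma tau) (phi v)) ->
  fps_act (permV sigma tau) (moser_fps k phi G i) =
  moser_fps k phi G (perm_index sigma tau i).
Proof.
move=> hphi; pose p := perm_index sigma tau.
have xp l : fps_act (permV sigma tau) (x l) = x (p l).
  by rewrite fps_act_fexp /= permV_eps.
have fp l : fps_act (permV sigma tau) (f l) = f (p l).
  by rewrite -hphi permV_eps.
have Gp r : r != i -> fps_act (permV sigma tau) (G i r) = G (p i) (p r).
  move=> ri; have pr : p i != p r.
    by rewrite (inj_eq (@perm_index_inj _ _ sigma tau)) eq_sym.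
  apply: (mulfI (exp_sub_neq0 C pr)); rewrite hG // -!fp -!xp -!rmorphB -rmorphM.
  by rewrite hG // eq_sym.
rewrite /moser_fps rmorphB /= -/p; congr (_ - _).
  rewrite -fp -permV_eps; apply/esym; apply: dV_act => u w.
  exact: permV_isometry.
rewrite rmorph_sum [RHS](reindex_inj (@perm_index_inj _ _ sigma tau)) /=.
rewrite [RHS](eq_bigl (fun r => r != i)); last first.
  by move=> r; rewrite /p (inj_eq (@perm_index_inj _ _ sigma tau)).
apply: eq_bigr => r ri; rewrite linearZ rmorphM /= parity_perm_index.
by rewrite xp Gp.
Qed.

(** The transposition of i and j lies in S_n x S_m, sends f_j to f_i, and moves every basis vector
    by a multiple of eps_i - eps_j. *)
Lemma even_root_sub i j : parity i = parity j ->
  (forall sigma tau v,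
     phi (permV sigma tau v) = fps_act (permV sigma tau) (phi v)) ->
  in_ideal (fvec (eps C i - eps C j)) (f i - f j).
Proof.
move=> pij hphi.
have [sigma [tau E]] : exists (sigma : 'S_n) (tau : 'S_m),
    perm_index sigma tau =1 tperm i j.
  move: pij; case: (split_ordP i) => a ->; case: (split_ordP j) => b -> /=.
  - move=> _; exists (tperm a b), 1%g => l; rewrite /perm_index.
    case: (split_ordP l) => c -> /=.
      by rewrite (inj_tperm _ _ _ (@lshift_inj _ _)).
    by rewrite perm1 tpermD // eq_lrshift.
  - by rewrite /parity /= leqNgt ltn_ord leq_addr.
  - by rewrite /parity /= [(n <= b)%N]leqNgt ltn_ord leq_addr.
  - move=> _; exists 1%g, (tperm a b) => l; rewrite /perm_index.
    case: (split_ordP l) => c -> /=.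
      by rewrite perm1 tpermD // eq_rlshift.
    by rewrite (inj_tperm _ _ _ (@rshift_inj _ _)).
have -> : f i = fps_act (permV sigma tau) (f j).
  by rewrite -hphi permV_eps E tpermR.
(* eps_j moves by +(eps_i - eps_j) and eps_i by -(eps_i - eps_j); the two coefficients cancel if i =
   j. *)
apply: (@fps_act_sub _ _ _ _ (fun l => (l == j)%:R - (l == i)%:R)) => l.
rewrite permV_eps E; case: tpermP => [->|->|/eqP li /eqP lj].
- have [->|ij] := eqVneq i j; first by rewrite !eqxx !subrr scaler0 addr0.
  by rewrite eqxx sub0r scaleN1r opprB addrC subrK.
- have [->|ij] := eqVneq i j; first by rewrite !eqxx !subrr scaler0 addr0.
  by rewrite eqxx subr0 scale1r addrC subrK.
- by rewrite (negPf li) (negPf lj) subrr scale0r addr0.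
Qed.

End MoserOperator.

(** * Linear maps determined by the basis *)

Section LinearExtension.
Context (C : fieldType) (N : nat) (W : lmodType C).
Implicit Types (F : 'I_N -> W).

Definition linear_ext F (v : 'rV[C]_N) : W := \sum_i v 0 i *: F i.

Lemma linear_ext_is_linear F : linear (linear_ext F).
Proof.
move=> c u v; rewrite /linear_ext scaler_sumr -big_split; apply: eq_bigr => i _.
by rewrite !mxE scalerDl scalerA.
Qed.
HB.instance Definition _ F :=
  GRing.isLinear.Build C 'rV[C]_N W *:%R (linear_ext F)
    (linear_ext_is_linear F).

Lemma linear_ext_eps F i : linear_ext F (eps C i) = F i.
Proof.
rewrite /linear_ext (bigD1 i) //= big1 => [|j ji]; rewrite !mxE ?eqxx.
  by rewrite scale1r addr0.
by rewrite (negPf ji) scale0r.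
Qed.

Lemma eq_linear_eps (g h : {linear 'rV[C]_N -> W}) :
  (forall i, g (eps C i) = h (eps C i)) -> g =1 h.
Proof.
move=> gh v; rewrite [v]row_sum_delta !linear_sum; apply: eq_bigr => i _ /=.
by rewrite !linearZ /= -/(eps C i) gh.
Qed.

End LinearExtension.

(** * Assembling the quasi-homomorphism psi *)

Section QuasiHom.
Context (C : numFieldType) (n m : nat) (k : C).
Local Notation V := 'rV[C]_(n + m).
Local Notation S := (fps C (n + m)).
Context (k1 : 1 + k != 0) (phi : {linear V -> S}).
Implicit Types (i j l r : 'I_(n + m)).

Local Notation x l := (fexp (eps C l) : S).
Local Notation f l := (phi (eps C l)).

Lemma parity_cases i : parity i = 0%N \/ parity i = 1%N.
Proof. by rewrite /parity; case: (n <= i)%N; [right | left]. Qed.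

Lemma odd_root_cases (alpha : V) : odd_root alpha ->
  exists i j, [/\ parity i = 0%N, parity j = 1%N
                & alpha = eps C i - eps C j \/ alpha = - (eps C i - eps C j)].
Proof.
move=> [i [j [_ + ->]]]; have [pi|pi] := parity_cases i;
  have [pj|pj] := parity_cases j; rewrite pi pj // => _.
  by exists i, j; split=> //; left.
by exists j, i; split=> //; right; rewrite opprB.
Qed.

(** Equal parities use a transposition; opposite parities use the criterion at the odd root, up to
    sign. *)
Lemma root_sub i j : quasi_hom k phi ->
  in_ideal (fvec (eps C i - eps C j)) (f i - f j).
Proof.
move=> [hperm hodd].
have h p q : parity p = 0%N -> parity q = 1%N ->
    in_ideal (fvec (eps C p - eps C q)) (f p - f q).
  move=> pp pq; have := odd_conditionP pp pq k1 phi => -[+ _].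
  case=> // v; apply: hodd; exists p, q; split=> //; last by rewrite pp pq.
  exact: odd_neq.
have [pi|pi] := parity_cases i; have [pj|pj] := parity_cases j.
- by apply: even_root_sub hperm; rewrite pi pj.
- exact: h.
- have [g hg] := h j i pj pi; exists g.
  by rewrite -opprB hg -mulrN -fvecN opprB.
- by apply: even_root_sub hperm; rewrite pi pj.
Qed.

Lemma moser_quasi_hom : quasi_hom_hatS k phi ->
  exists2 psi : {linear V -> S}, quasi_hom_hatS k psi &
    forall i, \sum_j moser k i j (f j) = tofps (psi (eps C i)).
Proof.
move=> [hphi hhat]; have [hperm hodd] := hphi.
have /choice[G' hG'] (p : 'I_(n + m) * 'I_(n + m)) : exists g : S,
    p.1 != p.2 -> in_hatS g /\ (x p.1 - x p.2) * g = f p.1 - f p.2.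
  (* On the diagonal the quotient is unconstrained, and 0 serves as a default. *)
  have [_|ij] := eqVneq p.1 p.2; first by exists 0.
  have hf : in_hatS (f p.1 - f p.2) by apply: in_hatSB; apply: hhat.
  by have [g hg E] := in_hatS_div ij hf (root_sub p.1 p.2 hphi); exists g.
pose G i j := G' (i, j).
have hatG i j : i != j -> in_hatS (G i j).
  by move=> ij; have [] := hG' (i, j) ij.
have hG i j : i != j -> (x i - x j) * G i j = f i - f j.
  by move=> ij; have [] := hG' (i, j) ij.
exists (linear_ext (moser_fps k phi G)); last first.
  by move=> i /=; rewrite linear_ext_eps (moser_sum k hG).
split; last first.
  move=> v; apply: in_hatS_sum => i _; apply: in_hatSZ; apply: in_hatSB.
    exact/in_hatS_dV/hhat.
  apply: in_hatS_sum => r ri; apply/in_hatSZ/in_hatSM.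
    exact: in_hatS_feps.
  by apply: hatG; rewrite eq_sym.
split=> [sigma tau v|alpha v].
  move: v; apply: (@eq_linear_eps _ _ _
    (linear_ext (moser_fps k phi G) \o permV sigma tau)
    (fps_act (permV sigma tau) \o linear_ext (moser_fps k phi G))) => i /=.
  by rewrite permV_eps !linear_ext_eps (moser_act k hG).
move=> /odd_root_cases[i [j [pi pj ij]]].
have [hr hw hl] : [/\ in_ideal (fvec (eps C i - eps C j)) (f i - f j),
    quasi_invariant k i j (k *: f i + f j) &
    forall l, l != i -> l != j -> quasi_invariant k i j (f l)].
  apply/(odd_conditionP pi pj k1 phi) => u; apply: hodd.
  by exists i, j; split=> //; [exact: odd_neq | rewrite pi pj].
suff main u : in_ideal (fvec (eps C i - eps C j) ^+ 2)
    (fps_act (reflection k (eps C i - eps C j))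
       (linear_ext (moser_fps k phi G) u)
     - linear_ext (moser_fps k phi G) (reflection k (eps C i - eps C j) u)).
  (* Opposite roots have the same reflection and the same square. *)
  case: ij => ->; first exact: main.
  rewrite fvecN sqrrN reflectionN (eq_fps_act (@reflectionN _ _ _ k _)).
  exact: main.
move: u; apply/(odd_conditionP pi pj k1 (linear_ext _)).
rewrite /= !linear_ext_eps; split; first exact: moser_root.
  exact: moser_orth.
by move=> l li lj; rewrite linear_ext_eps; apply: moser_qinv.
Qed.

End QuasiHom.

(** * Linear extension in the fraction field over the complex numbers *)

Theorem theorem2p7 (R : realType) (n m : nat) (k : R[i])
    (hn : (0 < n)%N) (hm : (0 < m)%N) (hk : forall q : rat, k <> ratr q)
    (phi : {linear 'rV[R[i]]_(n + m) -> fps R[i] (n + m)})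
    (hphi : quasi_hom_hatS k phi) :
  exists Psi : {linear 'rV[R[i]]_(n + m) -> fpsfrac R[i] (n + m)},
    [/\ forall i, Psi (eps R[i] i) = \sum_j moser k i j (phi (eps R[i] j)),
        forall Psi' : {linear 'rV[R[i]]_(n + m) -> fpsfrac R[i] (n + m)},
          (forall i, Psi' (eps R[i] i) = \sum_j moser k i j (phi (eps R[i] j))) ->
          Psi' =1 Psi
      & exists psi : {linear 'rV[R[i]]_(n + m) -> fps R[i] (n + m)},
          (forall v, Psi v = tofps (psi v)) /\ quasi_hom_hatS k psi].
Proof.
(* Irrationality excludes k = -1, so odd roots, of square length 1 + k, are not isotropic. *)
have k1 : 1 + k != 0.
  by apply/eqP => k0; apply: (hk (-1)); rewrite rmorphN1 -(addKr 1 k) k0 addr0.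
have [psi hpsi E] := moser_quasi_hom k1 hphi.
exists (@tofps _ _ \o psi); split=> [i|Psi' hPsi'|]; first by rewrite E.
  by apply: eq_linear_eps => i /=; rewrite hPsi' E.
by exists psi; split.
Qed.
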